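(* Let $\Gamma$ be a disjoint union of digraphs each of which is one of $P_n$ ($n\ge1$), $C_n$ ($n\ge2$), $K_n$ or $B_n$ ($n\ge1$). Then \[\mathrm X_\Gamma(\mathbf x;q)=\sum_{\theta\in AO(\Gamma)}q^{\mathrm{asc}_\Gamma(\theta)}\mathrm e_{\mu(\theta)}(\mathbf x).\]
   Context: For $\mathbf a=(a_1,\dots,a_n)$, $\Gamma_{\mathbf a}$ is the directed graph on $[n]$ with edges $i\to i+1,\dots,i\to i+a_i$ (labels mod $n$). $P_n=\Gamma_{(1,\dots,1,0)}$ (path; $P_1$ a single vertex), $C_n=\Gamma_{(1,\dots,1)}$ (cycle; for $n=2$ edges $1\to2$, $2\to1$), $K_n=\Gamma_{(n-1,n-2,\dots,0)}$ (edges $i\to j$, $i<j$), $B_n=\Gamma_{(n-1,\dots,n-1)}$ (edges $i\to j$ for all $i\ne j$). For a digraph $\Gamma$, $\mathrm X_\Gamma(\mathbf x;q)=\sum_F\mathbf x^Fq^{\mathrm{asc}(F)}$ over maps $F:V(\Gamma)\to\mathbb Z_{>0}$ with $F(u)\neq F(v)$ for every edge $u\to v$, $\mathbf x^F=\prod_vx_{F(v)}$, $\mathrm{asc}(F)$ the number of edges $u\to v$ with $F(u)<F(v)$. $AO(\Gamma)$ is the set of acyclic orientations $\theta$ of the underlying simple undirected graph of $\Gamma$ (vertices joined iff there is an edge in some direction); $\mathrm{asc}_\Gamma(\theta)$ is the number of directed edges of $\Gamma$ whose direction agrees with $\theta$. For each component with vertices labelled $1,\dots,m$ placed around a circle, each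 sink $s$ of $\theta$ determines a sector consisting of $s,s-1,s-2,\dots$ (labels mod $m$) up to but not including the next sink reached; the sectors partition the vertices, and $\mu(\theta)$ is the partition formed by the sizes of all sectors of all components. *)

(* Defs.v *)
From HB Require Import structures.
From mathcomp Require Import all_boot all_order all_algebra finmap multiset.
From mathcomp Require Import boolp classical_sets functions cardinality fsbigop.

Set Implicit Arguments.
Unset Strict Implicit.
Unset Printing Implicit Defensive.

Import GRing.Theory.
Local Open Scope ring_scope.

(** ** Formal power series in x_1, x_2, ... over Z[q] *)

Definition posint : Type := {k : nat | (0 < k)%N}.
HB.instance Definition _ := Countable.copy posint {k : nat | (0 < k)%N}.

(** The monomial x_{i_1} ... x_{i_d} is the multiset of indices
    {i_1, ..., i_d}; multiplication of monomials is the multiset sum [msetD]. *)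
Definition monomial : Type := {mset posint}%mset.
HB.instance Definition _ := Choice.copy monomial {mset posint}%mset.

(** A series is its family of coefficients. The variable q is ['X : {poly int}],
    and only the Z[q]-module structure of the function space is inherited: its
    ring structure is pointwise, which is not the product [smul] of series. *)
Definition series : Type := monomial -> {poly int}^o.
HB.instance Definition _ :=
  GRing.Lmodule.copy series (monomial -> {poly int}^o).

(** The series sum_(t in A) w(t) x^(mon t). In every use below only finitely many t in A
    share a given monomial, so the junk value 0 that [\sum_(t \in A)] takes on an
    infinite support never occurs. *)
Definition gen_series (T : choiceType) (A : set T) (mon : T -> monomial)
    (w : T -> {poly int}) : series :=
  fun m => \sum_(t \in [set t | A t /\ mon t = m]%classic) w t.

Definition smul (f g : series) : series :=
  fun m => \sum_(p \in [set p : monomial * monomial |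
                         msetD p.1 p.2 = m]%classic) ((f p.1 : {poly int}) * g p.2).

Definition sone : series := fun m => (m == mset0)%:R.

(** sum over i_1 < ... < i_k of x_{i_1} ... x_{i_k} *)
Definition elem (k : nat) : series :=
  gen_series [set I : {fset posint} | #|` I|%fset = k]%classic
    (fun I => seq_mset (enum_fset I)) (fun=> 1).

Definition elem_part (mu : seq nat) : series :=
  foldr (fun k f => smul (elem k) f) sone mu.

(** ** Digraphs, colourings and acyclic orientations *)

Section Digraph.
Variables (V : finType) (E : rel V).

Definition proper_colouring (F : V -> posint) : Prop :=
  forall u v, E u v -> F u <> F v.

Definition asc_colouring (F : V -> posint) : nat :=
  #|[set p : V * V | E p.1 p.2 && (val (F p.1) < val (F p.2))%N]|.

Definition chromatic_qsym : series :=
  gen_series [set F : {ffun V -> posint} | proper_colouring F]%classic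
    (fun F => seq_mset [seq F v | v <- enum V])
    (fun F => 'X^(asc_colouring F)).

Definition adjacent (u v : V) : bool := (u != v) && (E u v || E v u).

(** [(u, v) \in theta] means that the edge uv is oriented from u to v. *)
Definition orient (theta : {set V * V}) : rel V := fun u v => (u, v) \in theta.

Definition is_orientation (theta : {set V * V}) : bool :=
  [forall u, forall v,
     if adjacent u v then orient theta u v (+) orient theta v u
     else ~~ orient theta u v].

Definition acyclic (theta : {set V * V}) : bool :=
  [forall u, forall v, orient theta u v ==> ~~ connect (orient theta) v u].

Lemma acyclicP (theta : {set V * V}) :
  reflect (forall c : seq V, c <> [::] -> ~~ cycle (orient theta) c)
          (acyclic theta).
Proof.
apply: (iffP idP) => [ac [//|u c] _|nocyc].
  apply/negP => /= puc; case: c puc => [|v c] /= /andP[uv pv].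
    by have /forallP/(_ u)/forallP/(_ u) := ac; rewrite uv connect0.
  have /forallP/(_ u)/forallP/(_ v) := ac; rewrite uv /=; move/negP; apply.
  by apply/connectP; exists (rcons c u); rewrite ?last_rcons.
apply/forallP => u; apply/forallP => v; apply/implyP => uv.
apply/negP => /connectP[p pv uE].
have /negP := nocyc (v :: p) ltac:(by []).
by apply; rewrite /= rcons_path pv -uE.
Qed.

Definition AO : {set {set V * V}} :=
  [set theta | is_orientation theta && acyclic theta].

Definition asc_orientation (theta : {set V * V}) : nat :=
  #|[set p : V * V | E p.1 p.2 && orient theta p.1 p.2]|.

Definition sink (theta : {set V * V}) : pred V :=
  fun u => [forall v, ~~ orient theta u v].

End Digraph.

(** ** The circular digraphs and their disjoint unions *)

(** Labels are shifted: the vertex i of [n] is the ordinal i - 1. *)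
Definition circ_edge (n : nat) (a : {ffun 'I_n -> nat}) : rel 'I_n :=
  fun i j => has (fun k => j == (i + k) %% n :> nat)%N (iota 1 (a i)).

Definition path_arcs (n : nat) : {ffun 'I_n -> nat} :=
  [ffun i : 'I_n => if (i.+1 < n)%N then 1%N else 0%N].
Definition cycle_arcs (n : nat) : {ffun 'I_n -> nat} := [ffun=> 1%N].
Definition complete_arcs (n : nat) : {ffun 'I_n -> nat} :=
  [ffun i : 'I_n => (n.-1 - i)%N].
Definition bidirected_arcs (n : nat) : {ffun 'I_n -> nat} := [ffun=> n.-1].

Definition is_PCKB (n : nat) (a : {ffun 'I_n -> nat}) : Prop :=
  [\/ (1 <= n)%N /\ a = path_arcs n,
      (2 <= n)%N /\ a = cycle_arcs n,
      (1 <= n)%N /\ a = complete_arcs n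
    | (1 <= n)%N /\ a = bidirected_arcs n].

Section DisjointUnion.
Variables (r : nat) (n : 'I_r -> nat).

Definition union_vertex : finType := {i : 'I_r & 'I_(n i)}.

Definition union_edge (a : forall i, {ffun 'I_(n i) -> nat}) :
    rel union_vertex :=
  fun u v => (tag u == tag v) && circ_edge (a (tag u)) (tagged u) (tagged_as u v).

Definition prev_vertex (u : union_vertex) : union_vertex :=
  Tagged (fun i => 'I_(n i)) (ord_pred (tagged u)).

(** The vertices s - k such that none of s - 1, ..., s - k is a sink, with
    0 <= k < m where m is the size of the component of s: if s is the only
    sink of its component then its sector is the whole component. *)
Definition sector (theta : {set union_vertex * union_vertex})
    (s : union_vertex) : {set union_vertex} :=
  [set v | [exists k : 'I_(n (tag s)), (v == iter k prev_vertex s) &&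
     [forall j : 'I_(n (tag s)),
        (0 < j <= k)%N ==> ~~ sink theta (iter j prev_vertex s)]]].

Definition sector_part (theta : {set union_vertex * union_vertex}) : seq nat :=
  sort geq [seq #|sector theta s| | s <- enum (sink theta)].

End DisjointUnion.

(* Main.v *)
From HB Require Import structures.
From mathcomp Require Import boolp classical_sets fsbigop finmap multiset.
From mathcomp Require Import all_boot all_order all_algebra.
From mathcomp Require Import monalg ring zify.
Require Import Defs.

(** The identity is proved in finitely many colours over an arbitrary commutative
    ring and transferred to series coefficientwise. Both sides are multiplicative
    over disjoint unions. For K_n and B_n the colourings inducing a given acyclic
    orientation are determined by their set of values, so each orientation
    contributes e_n. For P_n and C_n both sides satisfy the same recursion

      y_n = c_n e_n + sum_(0 < k < n) q [k-1]_q e_k y_(n-k),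

    with c_n = [n]_q for paths and c_n = n q [n-1]_q for cycles. On the colouring
    side it comes from the transfer matrix w(c,d) x_d, where w(c,d) is q, 1 or 0
    as c < d, c > d or c = d: the vectors tau_k with entries e_k(w(c,.) x) satisfy
    M tau_k = tau_(k+1) + q [k]_q e_(k+1) tau_0. On the orientation side it is
    obtained by reading the orientations of the edges one after the other. *)

Set Implicit Arguments.
Unset Strict Implicit.
Unset Printing Implicit Defensive.

Import GRing.Theory.
Local Open Scope ring_scope.

(** * Symmetric polynomials and walks on colours *)

Section Symmetric.
Variables (A : comNzRingType) (q : A) (C : finType).
Implicit Types (x : C -> A) (J : {set C}).

(** The cycle is the hard case. A closed walk must return to its first colour a, so the transfer
    matrix acts on the unit vector at a instead of the all-one vector [tau_0]. Rotating the order of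
    the colours until a is least, and deleting a, leaves a matrix conjugate to one of the same kind;
    rescaled vectors [tau] of the rotated order, corrected at a, then do the work. Summed over a,
    the differences between e_n with and without x_a give n e_n, whence the factor n in c_n. On the
    orientation side the same constants count bit words: q [k-1]_q belongs to the words 0^a 1^b 0 of
    length k with b > 0, which fill the gap between two consecutive sinks, and c_n to the words with
    exactly one sink. For P_n and C_n no correspondence between colourings and orientations is used,
    only the two recursions. *)

Definition elsym x (k : nat) : A :=
  \sum_(J : {set C} | #|J| == k) \prod_(j in J) x j.

Definition qint (k : nat) : A := \sum_(i < k) q ^+ i.

(* The value -1 at 0 makes the recursion [hcoefS] hold from 0 on. *)
Definition hcoef (k : nat) : A := if k is k'.+1 then q * qint k' else -1.

Definition hsym x k := hcoef k * elsym x k.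

Lemma qint0 : qint 0 = 0.
Proof. by rewrite /qint big_ord0. Qed.

Lemma qintSl k : qint k.+1 = 1 + q * qint k.
Proof.
rewrite /qint big_ord_recl expr0 mulr_sumr; congr (_ + _).
by apply: eq_bigr => i _; rewrite exprS.
Qed.

Lemma qintSr k : qint k.+1 = qint k + q ^+ k.
Proof. by rewrite /qint big_ord_recr. Qed.

Lemma hcoefS k : hcoef k.+1 = q * (1 + hcoef k).
Proof. by case: k => [|k] /=; rewrite ?qint0 ?subrr // qintSl. Qed.

Lemma elsym0 x : elsym x 0 = 1.
Proof.
rewrite /elsym (big_pred1 set0) ?big_set0 // => J.
by rewrite cards_eq0.
Qed.

Lemma sum_add_element k (G : C -> {set C} -> A) :
  \sum_d \sum_(I : {set C} | (#|I| == k) && (d \notin I)) G d I =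
  \sum_(J : {set C} | #|J| == k.+1) \sum_(d in J) G d (J :\ d).
Proof.
rewrite [RHS](exchange_big_dep predT) //=; apply: eq_bigr => d _.
rewrite (reindex_onto (fun J => J :\ d) (fun I => d |: I)) /=; last first.
  by move=> I /andP[_ dI]; rewrite setU1K.
apply: eq_bigl => J; rewrite setD11 andbT.
have [dJ|dJ] := boolP (d \in J); rewrite ?andbT ?andbF.
  by rewrite setD1K // eqxx andbT (cardsD1 d J) dJ.
by apply/negbTE; apply: contra dJ => /andP[_ /eqP <-]; rewrite setU11.
Qed.

Section Order.
Variable rho : C -> nat.
Hypothesis rho_inj : injective rho.

Definition cmpw (c d : C) : A :=
  if c == d then 0 else if (rho c < rho d)%N then q else 1.

Definition above (J : {set C}) c := [set i in J | (rho c < rho i)%N].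

Lemma cmpw_prod c J :
  \prod_(i in J) cmpw c i = (c \notin J)%:R * q ^+ #|above J c|.
Proof.
have [cJ|cJ] := boolP (c \in J); rewrite ?mul0r ?mul1r.
  by rewrite (big_setD1 c) //= /cmpw eqxx mul0r.
rewrite -prodr_const big_mkcond [RHS]big_mkcond; apply: eq_bigr => i _.
rewrite inE /cmpw; have [iJ|//] := boolP (i \in J).
by rewrite /=; have [ci|//] := eqVneq c i; rewrite ci iJ in cJ.
Qed.

Lemma set_max_ind (P : {set C} -> Prop) :
  P set0 ->
  (forall J M, M \notin J -> (forall i, i \in J -> rho i < rho M)%N -> P J ->
     P (M |: J)) ->
  forall J, P J.
Proof.
move=> P0 PS J; move: {2}#|J| (erefl #|J|) => k; elim: k J => [|k IH] J.
  by move/eqP; rewrite cards_eq0 => /eqP ->.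
move=> Jk; have [c cJ] : exists c, c \in J by apply/card_gt0P; rewrite Jk.
have [M MJ Mmax] := @arg_maxnP C c [pred i in J] rho cJ.
rewrite /= in MJ.
rewrite -(setD1K MJ); apply: PS; rewrite ?setD11 //.
  move=> i; rewrite !inE => /andP[iM iJ].
  have le : (rho i <= rho M)%N := Mmax i iJ.
  rewrite ltn_neqAle le andbT; apply: contra iM => /eqP.
  by move/rho_inj->.
by apply: IH; move: Jk; rewrite (cardsD1 M J) MJ => -[].
Qed.

Lemma above_max J M c : M \notin J -> (forall i, i \in J -> rho i < rho M)%N ->
  #|above (M |: J) c| = ((rho c < rho M)%N + #|above J c|)%N.
Proof.
move=> MJ Mmax; have [cM|cM] := boolP (rho c < rho M)%N.
  rewrite (_ : above _ _ = M |: above J c) ?cardsU1 ?inE ?(negbTE MJ) //.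
  apply/setP => i; rewrite !inE.
  by have [->|] := eqVneq i M; rewrite ?cM.
congr #|pred_of_set _|; apply/setP => i; rewrite !inE.
by have [->|] := eqVneq i M; rewrite ?(negbTE cM) ?andbF.
Qed.

Lemma above_top J M : (forall i, i \in J -> rho i < rho M)%N -> #|above J M| = 0%N.
Proof.
move=> Mmax; apply/eqP; rewrite cards_eq0; apply/eqP/setP => i; rewrite !inE.
by apply/negbTE/andP => -[/Mmax + Mi]; rewrite ltnNge (ltnW Mi).
Qed.

(* In both sums the largest element of J contributes separately, while every
   other element gains one factor q. *)
Lemma sum_above J : \sum_(d in J) q ^+ #|above J d| = qint #|J|.
Proof.
elim/set_max_ind: J => [|J M MJ Mmax IH]; first by rewrite big_set0 cards0 qint0.
rewrite big_setU1 //= above_max // ltnn above_top //.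
rewrite cardsU1 MJ qintSl -IH mulr_sumr; congr (_ + _).
by apply: eq_bigr => d dJ; rewrite above_max // Mmax // exprS.
Qed.

Lemma sum_cmpw_above J c :
  \sum_(d in J) cmpw c d * q ^+ #|above J d| =
  (c \notin J)%:R * q ^+ #|above J c| + hcoef #|J|.
Proof.
elim/set_max_ind: J => [|J M MJ Mmax IH].
  by rewrite big_set0 cards0 inE above_top ?mul1r ?subrr // => i; rewrite inE.
rewrite big_setU1 //= above_max // ltnn above_top // mulr1.
have -> : \sum_(d in J) cmpw c d * q ^+ #|above (M |: J) d| =
          q * ((c \notin J)%:R * q ^+ #|above J c| + hcoef #|J|).
  rewrite -IH mulr_sumr; apply: eq_bigr => d dJ.
  by rewrite above_max // Mmax //= exprS mulrCA.
rewrite above_max // cardsU1 MJ add1n hcoefS in_setU1 /cmpw.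
have [->|cM] := eqVneq c M.
  by rewrite MJ above_top // ltnn /= mulr1n mulr0n; ring.
case: ltnP => [cM'|Mc] /=; first by rewrite exprS; ring.
have cJ : c \notin J by apply/negP => /Mmax; rewrite ltnNge Mc.
rewrite cJ above_top; last by move=> i /Mmax iM; exact: leq_trans iM Mc.
rewrite /= mulr1n; ring.
Qed.

Definition tau x c k := elsym (fun i => cmpw c i * x i) k.

(** The colour d joins a set counted by [tau x d k] to a set J of size [k.+1]; the factors
    [cmpw d i] leave a power of q counting the elements of J above d. The weight [G] stays free: a
    row of the transfer matrix gives [tau_step], the constant 1 gives [tau_sum]. *)
Lemma sum_tau (G : C -> A) x k :
  \sum_d G d * x d * tau x d k =
  \sum_(J : {set C} | #|J| == k.+1)
    (\prod_(j in J) x j) * \sum_(d in J) G d * q ^+ #|above J d|.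
Proof.
pose H d (I : {set C}) := G d * x d * \prod_(i in I) (cmpw d i * x i).
transitivity (\sum_d \sum_(I : {set C} | (#|I| == k) && (d \notin I)) H d I).
  apply: eq_bigr => d _; rewrite /tau /elsym mulr_sumr big_mkcondr /=.
  apply: eq_bigr => I _; case: ifPn => //; rewrite negbK => dI.
  by rewrite (big_setD1 d) //= /cmpw eqxx !(mul0r, mulr0).
rewrite sum_add_element; apply: eq_bigr => J _; rewrite mulr_sumr.
apply: eq_bigr => d dJ; rewrite /H big_split cmpw_prod setD11 mul1r /=.
rewrite [in RHS](big_setD1 d) //=.
have -> : above (J :\ d) d = above J d.
  by apply/setP => i; rewrite !inE; have [->|] := eqVneq i d; rewrite ?ltnn ?andbF.
ring.
Qed.

Lemma tau_step x c k :
  \sum_d cmpw c d * x d * tau x d k = tau x c k.+1 + hsym x k.+1.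
Proof.
rewrite sum_tau /tau /hsym /elsym mulr_sumr -big_split /=.
apply: eq_bigr => J /eqP Jk; rewrite sum_cmpw_above big_split cmpw_prod Jk /=.
ring.
Qed.

Lemma tau_sum x k : \sum_d x d * tau x d k = qint k.+1 * elsym x k.+1.
Proof.
rewrite (eq_bigr (fun d => 1 * x d * tau x d k)); last first.
  by move=> d _; rewrite mul1r.
rewrite sum_tau /elsym mulr_sumr; apply: eq_bigr => J /eqP <-.
rewrite -sum_above mulrC; congr (_ * _).
by apply: eq_bigr => d _; rewrite mul1r.
Qed.

Fixpoint open_walks x (m : nat) c : A :=
  if m is m'.+1 then \sum_d cmpw c d * x d * open_walks x m' d else 1.

(** [open_walks x m] is the m-th power of the transfer matrix applied to the all-one vector
    [tau x _ 0]. Each application raises the index of [tau] and emits a multiple [hsym] of the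
    all-one vector, from which a shorter walk starts afresh. *)
Lemma open_walks_tau x m c :
  open_walks x m c =
  tau x c m + \sum_(k < m) hsym x k.+1 * open_walks x (m - k.+1) c.
Proof.
elim: m c => [|m IH] c; first by rewrite big_ord0 addr0 /tau elsym0.
rewrite /= (eq_bigr (fun d => cmpw c d * x d * tau x d m +
  \sum_(k < m) hsym x k.+1 * (cmpw c d * x d * open_walks x (m - k.+1) d))).
  rewrite big_split tau_step exchange_big big_ord_recr subnn /= mulr1.
  rewrite -[in LHS]addrA [in LHS](addrC (hsym _ _)); congr (_ + (_ + _)).
  apply: eq_bigr => k _; rewrite -mulr_sumr subSS -[in RHS](subnSK (ltn_ord k)).
  by [].
move=> d _; rewrite IH mulrDr; congr (_ + _); rewrite mulr_sumr.
by apply: eq_bigr => k _; rewrite mulrCA.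
Qed.

Definition path_sum x n := \sum_c x c * open_walks x n.-1 c.

Lemma path_sum_rec x n :
  path_sum x n.+1 = qint n.+1 * elsym x n.+1 +
    \sum_(k < n) hsym x k.+1 * path_sum x (n - k).
Proof.
rewrite /path_sum /=.
rewrite (eq_bigr (fun c => x c * tau x c n +
  \sum_(k < n) hsym x k.+1 * (x c * open_walks x (n - k.+1) c))).
  rewrite big_split tau_sum exchange_big /=; congr (_ + _).
  by apply: eq_bigr => k _; rewrite -mulr_sumr subnS.
move=> c _; rewrite open_walks_tau mulrDr; congr (_ + _); rewrite mulr_sumr.
by apply: eq_bigr => k _; rewrite mulrCA.
Qed.

Fixpoint walks_to x a (m : nat) c : A :=
  if m is m'.+1 then \sum_d cmpw c d * x d * walks_to x a m' d
  else (c == a)%:R.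

Definition cycle_sum x n := \sum_a walks_to x a n a.

End Order.

(** * Deleting a colour; closed walks *)

Definition omit x a := fun c => if c == a then 0 else x c.

Lemma omit_prod x a J :
  \prod_(j in J) omit x a j = (a \notin J)%:R * \prod_(j in J) x j.
Proof.
have [aJ|aJ] := boolP (a \in J); rewrite ?mul0r ?mul1r.
  by rewrite (big_setD1 a) //= /omit eqxx mul0r.
apply: eq_bigr => j jJ; rewrite /omit; case: eqP => // ja.
by rewrite -ja jJ in aJ.
Qed.

Lemma elsym_omit x a k :
  elsym x k.+1 = elsym (omit x a) k.+1 + x a * elsym (omit x a) k.
Proof.
rewrite {1}/elsym (bigID (fun J : {set C} => a \notin J)) /=; congr (_ + _).
  rewrite big_mkcondr /elsym; apply: eq_bigr => J _; rewrite omit_prod.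
  by case: ifP; rewrite ?mul1r ?mul0r.
rewrite /elsym mulr_sumr.
rewrite (reindex_onto (fun I => a |: I) (fun J => J :\ a)) /=; last first.
  by move=> J /andP[_]; rewrite negbK => aJ; rewrite setD1K.
rewrite [RHS](bigID (fun J : {set C} => a \in J)) /= [X in _ = X + _]big1 ?add0r; last first.
  by move=> J /andP[_ aJ]; rewrite omit_prod aJ mul0r mulr0.
apply: eq_big => [I|I].
  rewrite setU11 /= cardsU1 andbT; have [aI|aI] := boolP (a \in I).
    rewrite andbF; apply/negbTE/negP => /andP[_ /eqP] /setP/(_ a).
    by rewrite setD11 aI.
  by rewrite setU1K // eqxx !andbT.
case/andP=> /andP[_ _] /eqP eI.
have aI : a \notin I by rewrite -eI setD11.
by rewrite big_setU1 //= omit_prod aI mul1r.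
Qed.

(** The difference at a keeps the products over sets containing a, so a set of size k is counted
    once for each of its elements. *)
Lemma sum_elsym_omit x k :
  \sum_a (elsym x k - elsym (omit x a) k) = k%:R * elsym x k.
Proof.
rewrite (eq_bigr (fun a => \sum_(J : {set C} | #|J| == k)
   (a \in J)%:R * \prod_(j in J) x j)); last first.
  move=> a _; rewrite /elsym -sumrB; apply: eq_bigr => J _; rewrite omit_prod.
  by case: (a \in J); rewrite ?mul0r ?mul1r ?subr0 ?subrr.
rewrite exchange_big /elsym mulr_sumr; apply: eq_bigr => J /eqP <- /=.
by rewrite -mulr_suml -natr_sum -big_mkcond sum1_card.
Qed.

Section CyclicOrder.
Variable rho : C -> nat.
Hypothesis rho_inj : injective rho.
Variable a : C.

(* The order of the colours rotated so that [a] becomes its least element. *)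
Definition rot_rank c :=
  (if rho c < rho a then rho c + (\max_d rho d).+1 else rho c)%N.

Definition rot_scale c : A := if (rho c < rho a)%N then q else 1.

Lemma rot_rank_inj : injective rot_rank.
Proof.
have lt d : (rho d < (\max_d rho d).+1)%N by rewrite ltnS (leq_bigmax d).
move=> c d; rewrite /rot_rank; case: ifP => _; case: ifP => _.
- by move/addIn/rho_inj.
- by move=> e; move: (lt d); rewrite -e ltnNge leq_addl.
- by move=> e; move: (lt c); rewrite e ltnNge leq_addl.
- by move/rho_inj.
Qed.

(* Rotating the order conjugates the matrix [cmpw] by a diagonal one away from
   [a]; this is why the ascents of a closed walk only depend on the cyclic order. *)
Lemma cmpw_rot c d : c != a -> d != a ->
  cmpw rho c d * rot_scale d = rot_scale c * cmpw rot_rank c d.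
Proof.
move=> ca da; rewrite /cmpw /rot_scale /rot_rank.
have [_|cd] := eqVneq c d; first by rewrite mul0r mulr0.
have lt e : (rho e < (\max_d rho d).+1)%N by rewrite ltnS (leq_bigmax e).
have nea e : e != a -> ~~ (rho e < rho a)%N -> (rho a < rho e)%N.
  move=> ea; rewrite -leqNgt leq_eqVlt => /orP[/eqP/rho_inj E|//].
  by rewrite E eqxx in ea.
case: (boolP (rho c < rho a)%N) => [ca'|/(nea _ ca) ca'];
  case: (boolP (rho d < rho a)%N) => [da'|/(nea _ da) da'].
- by rewrite ltn_add2r mulrC.
- by rewrite (ltn_trans ca' da') ltnNge (leq_trans (ltnW (lt d))) ?leq_addl.
- rewrite ltnNge (ltnW (ltn_trans da' ca')) /=.
  by rewrite (leq_trans (lt c)) ?leq_addl // mul1r.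
- by rewrite mulrC.
Qed.

Lemma cmpw_to c : c != a -> cmpw rho c a = rot_scale c.
Proof. by rewrite /cmpw /rot_scale => /negbTE ->. Qed.

(** The step from a to d brings a q when d lies above a, the rescaling when d lies below; the
    constant product leaves the unweighted sum over d evaluated by [tau_sum]. *)
Lemma cmpw_from d : d != a -> cmpw rho a d * rot_scale d = q.
Proof.
move=> da; rewrite /cmpw /rot_scale eq_sym (negbTE da).
case: (ltngtP (rho d) (rho a)) => [||/rho_inj E]; rewrite ?mul1r ?mulr1 //.
by rewrite E eqxx in da.
Qed.

(* The vectors [sigma x n] are the coefficients of D(z) (1 - z M)^-1 delta_a, where
   M is the transfer matrix and D(z) = - sum_k hsym x k z^k its characteristic
   series. *)
Definition sigma x n c : A :=
  if n is m.+1 then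
    if c == a then - hsym (omit x a) n
    else x a * rot_scale c * tau rot_rank (omit x a) c m
  else (c == a)%:R.

Lemma sigma_step x n c :
  \sum_d cmpw rho c d * x d * sigma x n d =
  sigma x n.+1 c + (c == a)%:R * hsym x n.+1.
Proof.
case: n => [|m].
  rewrite (bigD1 a) //= eqxx big1 ?addr0 => [|d /negbTE ->]; last by rewrite mulr0.
  have [->|ca] := eqVneq c a.
    by rewrite /cmpw eqxx /hsym /= qint0; ring.
  by rewrite cmpw_to // /tau elsym0 mulr1n mulr0n; ring.
rewrite (bigD1 a) //= eqxx; have [->|ca] := eqVneq c a.
  rewrite {1}/cmpw eqxx !mul0r add0r mul1r.
  rewrite (eq_bigr (fun d => q * x a * (omit x a d * tau rot_rank (omit x a) d m))).
    (* [tau_sum] runs over every colour, but its term at [a] vanishes because [omit x a] does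
       there. *)
    have /= E := tau_sum rot_rank_inj (omit x a) m.
    rewrite -mulr_sumr; rewrite (bigD1 a) //= {1}/omit eqxx mul0r add0r in E.
    rewrite E /hsym (elsym_omit x a) /=; ring.
  move=> d da; rewrite (negbTE da) {2}/omit (negbTE da) -(cmpw_from da); ring.
rewrite mul0r addr0 cmpw_to //.
rewrite (eq_bigr (fun d => x a * rot_scale c *
  (cmpw rot_rank c d * omit x a d * tau rot_rank (omit x a) d m))).
  have E := tau_step rot_rank_inj (omit x a) c m.
  rewrite (bigD1 a) //= {1}/omit eqxx mulr0 mul0r add0r in E.
  rewrite -mulr_sumr E; ring.
move=> d da; rewrite (negbTE da) {2}/omit (negbTE da).
transitivity (x a * x d * tau rot_rank (omit x a) d m *
  (cmpw rho c d * rot_scale d)); first by ring.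
rewrite cmpw_rot //; ring.
Qed.

Lemma walks_to_sigma x n c :
  walks_to rho x a n c =
  sigma x n c + \sum_(k < n) hsym x k.+1 * walks_to rho x a (n - k.+1) c.
Proof.
elim: n c => [|m IH] c; first by rewrite big_ord0 addr0.
rewrite [LHS]/= (eq_bigr (fun d => cmpw rho c d * x d * sigma x m d +
  \sum_(k < m) hsym x k.+1 * (cmpw rho c d * x d * walks_to rho x a (m - k.+1) d))).
  rewrite big_split sigma_step exchange_big big_ord_recr subnn.
  set S := sigma _ _ _; rewrite /=.
  rewrite -[in LHS]addrA [in LHS](addrC (_ * hsym _ _)) (mulrC (hsym _ m.+1)).
  congr (_ + (_ + _)).
  by apply: eq_bigr => k _; rewrite -mulr_sumr subSS -[in RHS](subnSK (ltn_ord k)).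
move=> d _; rewrite IH mulrDr; congr (_ + _); rewrite mulr_sumr.
by apply: eq_bigr => k _; rewrite mulrCA.
Qed.

End CyclicOrder.

Lemma cycle_sum_rec (rho : C -> nat) x n : injective rho ->
  cycle_sum rho x n.+1 = n.+1%:R * hsym x n.+1 +
    \sum_(k < n) hsym x k.+1 * cycle_sum rho x (n - k).
Proof.
move=> rho_inj; rewrite {1}/cycle_sum.
rewrite (eq_bigr (fun a => hcoef n.+1 * (elsym x n.+1 - elsym (omit x a) n.+1) +
  \sum_(k < n) hsym x k.+1 * walks_to rho x a (n - k) a)).
  rewrite big_split -mulr_sumr sum_elsym_omit exchange_big /=; congr (_ + _).
    by rewrite /hsym mulrCA.
  by apply: eq_bigr => k _; rewrite -mulr_sumr.
(* The term k = n contains the walk of length 0, equal to 1 at [a]; it merges with [sigma] at [a]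
   into the difference of elementary polynomials. *)
move=> a _; rewrite (walks_to_sigma rho_inj) big_ord_recr subnn /= eqxx mulr1.
rewrite (addrC (\sum_(_ < _) _)) addrA /hsym; congr (_ + _).
by rewrite mulrBr addrC.
Qed.

End Symmetric.

(** * Words of sinks *)

Lemma big_tuple_cons (R : nmodType) (T : finType) n (f : seq T -> R) :
  \sum_(t : n.+1.-tuple T) f t = \sum_b \sum_(t : n.-tuple T) f (b :: t).
Proof.
rewrite pair_big /= (reindex (fun p : T * n.-tuple T => [tuple of p.1 :: p.2])) //=.
exists (fun t : n.+1.-tuple T => (thead t, behead_tuple t)).
  by case=> b t _ /=; congr (_, _); apply: val_inj.
by move=> t _; rewrite [t in RHS]tuple_eta /=; apply: val_inj.
Qed.

Lemma big_tuple0 (R : nmodType) (T : finType) (f : seq T -> R) :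
  \sum_(t : 0.-tuple T) f t = f [::].
Proof. by rewrite (big_pred1 [tuple]) // => t; apply/esym/eqP/tuple0. Qed.

Section SinkWords.
Variables (A : comNzRingType) (q : A) (e : nat -> A).
Implicit Types (s : seq bool) (p pe : bool).

(* [s] marks the sinks among consecutive vertices. [linear_weight h k s] is the
   product of [e (size of sector)] over the sinks of [s] after the first sink, [k]
   being the number of vertices passed since the previous sink; the vertices
   left over after the last sink join the [h] vertices up to the first one. *)
Fixpoint linear_weight (h k : nat) s : A :=
  if s is b :: s' then
    if b then e k.+1 * linear_weight h 0 s' else linear_weight h k.+1 s'
  else e (h + k).

(** [j] counts the vertices before the first sink, which belong to its sector. The value 0 in the
    absence of sinks removes from unrestricted sums the two constant bit words, which would orient a
    cycle cyclically. *)
Fixpoint cyclic_weight (j : nat) s : A :=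
  if s is b :: s' then
    if b then linear_weight j.+1 0 s' else cyclic_weight j.+1 s'
  else 0.

(* A bit records whether the edge from a vertex to its successor is oriented
   upwards, so a vertex is a sink iff the bit before it is 1 and its own is 0. *)
Definition sinks_of_bits p s := pairmap (fun b b' => b && ~~ b') p s.

Definition bit_sum n (f : seq bool -> A) : A :=
  \sum_(t : n.-tuple bool) q ^+ count id t * f t.

Lemma bit_sum0 f : bit_sum 0 f = f [::].
Proof.
by rewrite /bit_sum (big_tuple0 (fun t => q ^+ count id t * f t)) mul1r.
Qed.

Lemma bit_sumS n f :
  bit_sum n.+1 f =
  bit_sum n (fun s => f (false :: s)) + q * bit_sum n (fun s => f (true :: s)).
Proof.
rewrite /bit_sum (big_tuple_cons _ (fun t => q ^+ count id t * f t)).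
rewrite big_bool addrC; congr (_ + _); rewrite mulr_sumr.
by apply: eq_bigr => t _; rewrite /= exprS mulrA.
Qed.

Lemma eq_bit_sum n f g : f =1 g -> bit_sum n f = bit_sum n g.
Proof. by move=> fg; apply: eq_bigr => t _; rewrite fg. Qed.

Lemma bit_sumZ n c f : bit_sum n (fun s => c * f s) = c * bit_sum n f.
Proof.
by rewrite /bit_sum mulr_sumr; apply: eq_bigr => t _; rewrite mulrCA.
Qed.

(** [p] is the bit before the word and [pe] the bit it must end with. On a cycle the two are equal;
    a path takes 1 before its first vertex and 0 at its last. *)
Definition linear_sum pe p h k n :=
  bit_sum n (fun s =>
    if last p s == pe then linear_weight h k (sinks_of_bits p s) else 0).

Definition cyclic_sum pe p j n :=
  bit_sum n (fun s =>
    if last p s == pe then cyclic_weight j (sinks_of_bits p s) else 0).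

Let hs k := hcoef q k * e k.

Lemma linear_sum0 pe p h k :
  linear_sum pe p h k 0 = if p == pe then e (h + k) else 0.
Proof. exact: bit_sum0. Qed.

Lemma linear_sumSf pe h k n :
  linear_sum pe false h k n.+1 =
  linear_sum pe false h k.+1 n + q * linear_sum pe true h k.+1 n.
Proof. exact: bit_sumS. Qed.

Lemma linear_sumSt pe h k n :
  linear_sum pe true h k n.+1 =
  e k.+1 * linear_sum pe false h 0 n + q * linear_sum pe true h k.+1 n.
Proof.
rewrite /linear_sum bit_sumS -(bit_sumZ n (e k.+1)); congr (_ + _).
by apply: eq_bit_sum => s /=; case: ifP => //; rewrite mulr0.
Qed.

(** After a 1 the next 0 marks a sink, so i is the length of the initial run of 1s. *)
Lemma linear_sum_true pe h k n :
  linear_sum pe true h k n =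
  q ^+ n * (if pe then e (h + k + n) else 0) +
  \sum_(i < n) q ^+ i * e (k + i).+1 * linear_sum pe false h 0 (n - i.+1).
Proof.
elim: n k => [|n IH] k.
  by rewrite linear_sum0 big_ord0 addr0 mul1r addn0; case: pe.
rewrite linear_sumSt IH big_ord_recl expr0 mul1r addn0 subSS subn0 mulrDr.
rewrite addrCA mulrA -exprS !addnS addSn; congr (_ + (_ + _)).
rewrite mulr_sumr; apply: eq_bigr => i _.
by rewrite /= addnS addSn exprS -!mulrA subSS.
Qed.

(** Generating function of the words 0^a 1^b of length n, read after a 0 and ending in [pe]: those
    that produce no further sink. *)
Definition end_coef pe n : A := if pe then q * qint q n else 1.

(** From a 0 to the next sink the bits read 0^a 1^b 0 with b > 0; for a + b = i the weights add up
    to q + ... + q^i, which is [hcoef q i.+1]. *)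
Lemma linear_sum_false pe h k n :
  linear_sum pe false h k n =
  end_coef pe n * e (h + k + n) +
  \sum_(i < n) hcoef q i.+1 * e (k + i).+1 * linear_sum pe false h 0 (n - i.+1).
Proof.
elim: n k => [|n IH] k.
  rewrite linear_sum0 big_ord0 addr0 addn0 /end_coef qint0.
  by case: pe; rewrite ?mulr0 ?mul0r ?mul1r.
rewrite linear_sumSf IH linear_sum_true big_ord_recl /= qint0 mulr0 !mul0r add0r.
rewrite mulrDr addrACA mulr_sumr -big_split /= !addnS !addSn; congr (_ + _).
  by rewrite /end_coef; case: (pe); rewrite ?qintSr; ring.
apply: eq_bigr => i _.
rewrite /= addnS addSn subSS qintSr; ring.
Qed.

Lemma cyclic_sum0 pe p j : cyclic_sum pe p j 0 = 0.
Proof. by rewrite /cyclic_sum bit_sum0 /=; case: ifP. Qed.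

Lemma cyclic_sumSf pe j n :
  cyclic_sum pe false j n.+1 =
  cyclic_sum pe false j.+1 n + q * cyclic_sum pe true j.+1 n.
Proof. exact: bit_sumS. Qed.

Lemma cyclic_sumSt pe j n :
  cyclic_sum pe true j n.+1 =
  linear_sum pe false j.+1 0 n + q * cyclic_sum pe true j.+1 n.
Proof. exact: bit_sumS. Qed.

(** Generating function of the words of length n with exactly one sink, read after the bit [p] and
    ending in [pe]. *)
Fixpoint start_coef pe p n : A :=
  if n is n'.+1 then
    (if p then end_coef pe n' else start_coef pe false n') +
    q * start_coef pe true n'
  else 0.

(** A single sink has all j + n vertices in its sector. Otherwise the stretch from just after the
    first sink to the second is the sector of the second; it follows a 0 and ends in a 0, so cutting
    it out changes no other sink. *)
Lemma cyclic_sum_rec pe p j n :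
  cyclic_sum pe p j n =
  start_coef pe p n * e (j + n) +
  \sum_(i < n) hs i.+1 * cyclic_sum pe p j (n - i.+1).
Proof.
elim: n p j => [|n IH] p j; first by rewrite big_ord0 cyclic_sum0 mul0r addr0.
rewrite big_ord_recr /= subnn cyclic_sum0 mulr0 addr0.
case: p; rewrite ?cyclic_sumSf ?cyclic_sumSt !IH ?linear_sum_false;
  rewrite mulrDr addrACA ?addn0 addSnnS mulrA -mulrDl; congr (_ + _);
  rewrite mulr_sumr -big_split; apply: eq_bigr => i _ /=;
  rewrite subSS -[in RHS](subnSK (ltn_ord i)) ?cyclic_sumSf ?cyclic_sumSt ?add0n /hs /=;
  ring.
Qed.

Lemma start_coef_path n : start_coef false true n = qint q n.
Proof. by elim: n => [|n IH] /=; rewrite ?qint0 // IH -qintSl. Qed.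

(** The cyclic words with exactly one sink are the [n.+1] rotations of 1^i 0^(n+1-i) for 0 < i <= n;
    the two summands separate them by their last bit. *)
Lemma start_coef_cycle n :
  start_coef true true n.+1 + start_coef false false n.+1 = n.+1%:R * hcoef q n.+1.
Proof.
(* The words are 1^a 0^b 1^c with b, c > 0, and a + c = i leaves i choices of c. *)
have Et m : start_coef true true m = \sum_(i < m) i%:R * q ^+ i.
  elim: m => [|m IH]; first by rewrite big_ord0.
  rewrite /= IH big_ord_recl mul0r add0r /qint !mulr_sumr -big_split.
  by apply: eq_bigr => i _; rewrite /= exprS -natr1; ring.
rewrite !Et; elim: n => [|n IH].
  by rewrite big_ord1 /= qint0; ring.
have -> : start_coef false false n.+2 =
  start_coef false false n.+1 + q * start_coef false true n.+1 by [].
have -> : start_coef false false n.+1 = n.+1%:R * hcoef q n.+1 -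
    \sum_(i < n.+1) i%:R * q ^+ i by rewrite -IH addrC addKr.
rewrite start_coef_path big_ord_recr /= qintSr -[n.+2%:R]natr1 exprS.
ring.
Qed.

End SinkWords.

(** * Colourings of paths and cycles *)

Section Words.
Variables (A : comNzRingType) (q : A) (C : finType) (rho : C -> nat).
Hypothesis rho_inj : injective rho.
Variable x : C -> A.
Local Notation w := (cmpw q rho).

Lemma unique_recursion (h c f g : nat -> A) :
  (forall n, f n.+1 = c n + \sum_(k < n) h k * f (n - k)%N) ->
  (forall n, g n.+1 = c n + \sum_(k < n) h k * g (n - k)%N) ->
  forall n, f n.+1 = g n.+1.
Proof.
move=> Hf Hg n; elim/ltn_ind: n => n IH; rewrite Hf Hg; congr (_ + _).
apply: eq_bigr => k _; congr (_ * _).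
by rewrite -(subnSK (ltn_ord k)); apply: IH; rewrite subnSK // leq_subr.
Qed.

Lemma path_sum_bits n :
  path_sum q rho x n.+1 = cyclic_sum q (elsym x) false true 0 n.+1.
Proof.
apply: (unique_recursion (c := fun n => qint q n.+1 * elsym x n.+1)
  (h := fun k => hsym q x k.+1) (f := path_sum q rho x)) n => n.
  exact: path_sum_rec.
rewrite cyclic_sum_rec start_coef_path big_ord_recr /= subnn cyclic_sum0.
by rewrite mulr0 addr0.
Qed.

Lemma cycle_sum_bits n :
  cycle_sum q rho x n.+1 =
  cyclic_sum q (elsym x) true true 0 n.+1 + cyclic_sum q (elsym x) false false 0 n.+1.
Proof.
apply: (unique_recursion (c := fun n => n.+1%:R * hsym q x n.+1)
  (h := fun k => hsym q x k.+1) (f := cycle_sum q rho x)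
  (g := fun n => cyclic_sum q (elsym x) true true 0 n +
                 cyclic_sum q (elsym x) false false 0 n)) n => n.
  exact: cycle_sum_rec.
rewrite !cyclic_sum_rec !big_ord_recr /= !subnn !cyclic_sum0 !mulr0 !addr0.
rewrite addrACA -mulrDl start_coef_cycle -mulrA -big_split; congr (_ + _).
by apply: eq_bigr => k _; rewrite mulrDr.
Qed.

Fixpoint word_weight c (s : seq C) : A :=
  if s is d :: s' then w c d * word_weight d s' else 1.

Lemma word_weightE c0 c s :
  word_weight c s = \prod_(i < size s) w (nth c0 (c :: s) i) (nth c0 s i).
Proof.
elim: s c => [|d s IH] c /=; first by rewrite big_ord0.
by rewrite big_ord_recl IH.
Qed.

Lemma open_walks_words m c :
  open_walks q rho x m c =
  \sum_(s : m.-tuple C) (\prod_(d <- s) x d) * word_weight c s.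
Proof.
elim: m c => [|m IH] c.
  rewrite (big_tuple0 (fun s => (\prod_(d <- s) x d) * word_weight c s)).
  by rewrite big_nil mul1r.
rewrite (big_tuple_cons _ (fun s => (\prod_(d <- s) x d) * word_weight c s)) /=.
apply: eq_bigr => d _; rewrite IH mulr_sumr; apply: eq_bigr => s _.
by rewrite big_cons; ring.
Qed.

Lemma walks_to_words a m c :
  walks_to q rho x a m.+1 c =
  \sum_(s : m.-tuple C)
    x a * (\prod_(d <- s) x d) * (word_weight c s * w (last c s) a).
Proof.
elim: m c => [|m IH] c.
  rewrite (big_tuple0
    (fun s => x a * (\prod_(d <- s) x d) * (word_weight c s * w (last c s) a))).
  rewrite big_nil /= (bigD1 a) //= eqxx big1 => [|d /negbTE ->]; last by rewrite mulr0.
  by rewrite mulr1n; ring.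
rewrite (big_tuple_cons _
  (fun s => x a * (\prod_(d <- s) x d) * (word_weight c s * w (last c s) a))).
rewrite [LHS]/=.
apply: eq_bigr => d _; rewrite -/(walks_to q rho x a m.+1 d) IH mulr_sumr.
by apply: eq_bigr => s _; rewrite big_cons /=; ring.
Qed.

End Words.

Section ColouringSum.
Variables (A : comNzRingType) (q : A) (C : finType) (rho : C -> nat) (x : C -> A).
Local Notation w := (cmpw q rho).

(** Since [cmpw] vanishes on equal colours, properness and ascents sit in one product over pairs of
    vertices, and the sum over all maps can factor over components. *)
Definition colouring_sum (V : finType) (E : rel V) : A :=
  \sum_(F : {ffun V -> C})
    (\prod_v x (F v)) * \prod_u \prod_v (if E u v then w (F u) (F v) else 1).

Lemma sum_ffun_tuple n (g : {ffun 'I_n -> C} -> A) :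
  \sum_F g F = \sum_(t : n.-tuple C) g [ffun i => tnth t i].
Proof.
rewrite (reindex (fun t : n.-tuple C => [ffun i => tnth t i])) //=.
exists (fun F : {ffun 'I_n -> C} => [tuple F i | i < n]) => [t _|F _].
  by apply: eq_from_tnth => i; rewrite tnth_mktuple ffunE.
by apply/ffunP => i; rewrite ffunE tnth_mktuple.
Qed.

Lemma prod_one_out (n : nat) (P : pred 'I_n) (F : 'I_n -> 'I_n -> A) :
  \prod_u \prod_v (if P u && (v == ordS u) then F u v else 1) =
  \prod_(u | P u) F u (ordS u).
Proof.
rewrite [RHS]big_mkcond; apply: eq_bigr => u _.
case: (P u) => /=; last by rewrite big1.
by rewrite -big_mkcond big_pred1_eq.
Qed.

Lemma word_weight_ord n c (s : n.-tuple C) (F := tnth [tuple of c :: s]) :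
  \prod_(u : 'I_n.+1 | (u < n)%N) w (F u) (F (ordS u)) = word_weight q rho c s.
Proof.
rewrite (word_weightE _ _ c) size_tuple big_mkcond big_ord_recr /= ltnn mulr1.
apply: eq_bigr => i _; rewrite ltn_ord /F !(tnth_nth c) /=.
by rewrite modn_small // ltnS ltn_ord.
Qed.

Lemma colouring_sum_path n (E : rel 'I_n) :
  (forall u v, E u v = (u.+1 < n)%N && (v == ordS u)) -> (0 < n)%N ->
  colouring_sum E = path_sum q rho x n.
Proof.
case: n E => // n E HE _; rewrite /colouring_sum /path_sum /= sum_ffun_tuple.
pose f (s : seq C) := (\prod_(d <- s) x d) *
  (if s is c :: s' then word_weight q rho c s' else 1).
rewrite (eq_bigr (fun t : n.+1.-tuple C => f t)) => [|t _].
  rewrite big_tuple_cons; apply: eq_bigr => c _.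
  rewrite open_walks_words mulr_sumr; apply: eq_bigr => s _.
  by rewrite /f big_cons mulrA.
rewrite /f; congr (_ * _).
  by rewrite big_tuple; apply: eq_bigr => i _; rewrite ffunE.
case/tupleP: t => c s /=; rewrite -word_weight_ord.
rewrite -(prod_one_out (fun u : 'I_n.+1 => u < n)%N
  (fun u v => w (tnth [tuple of c :: s] u) (tnth [tuple of c :: s] v))).
by apply: eq_bigr => u _; apply: eq_bigr => v _; rewrite HE !ffunE.
Qed.

Lemma colouring_sum_cycle n (E : rel 'I_n) :
  (forall u v, E u v = (v == ordS u)) -> (0 < n)%N ->
  colouring_sum E = cycle_sum q rho x n.
Proof.
case: n E => // n E HE _; rewrite /colouring_sum /cycle_sum sum_ffun_tuple.
pose f (s : seq C) := (\prod_(d <- s) x d) *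
  (if s is c :: s' then word_weight q rho c s' * w (last c s') c else 1).
rewrite (eq_bigr (fun t : n.+1.-tuple C => f t)) => [|t _].
  rewrite big_tuple_cons; apply: eq_bigr => c _.
  by rewrite walks_to_words; apply: eq_bigr => s _; rewrite /f big_cons.
rewrite /f; congr (_ * _).
  by rewrite big_tuple; apply: eq_bigr => i _; rewrite ffunE.
case/tupleP: t => c s /=; rewrite -word_weight_ord.
set F := tnth _.
transitivity (\prod_(u : 'I_n.+1) w (F u) (F (ordS u))).
  rewrite -(prod_one_out predT (fun u v => w (F u) (F v))).
  by apply: eq_bigr => u _; apply: eq_bigr => v _; rewrite HE !ffunE.
rewrite (bigID (fun u : 'I_n.+1 => u < n)%N) /=; congr (_ * _).
rewrite (big_pred1 ord_max) => [|u]; last first.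
  by rewrite /= -leqNgt -val_eqE /= eqn_leq leq_ord.
by rewrite /F !(tnth_nth c) /= modnn /= (last_nth c) size_tuple.
Qed.

End ColouringSum.

(** * Sectors and orientations of paths and cycles *)

Section Sectors.
Variables (A : comNzRingType) (e : nat -> A).

(** [p] is the part of the word already read, from which both counters are recovered: the position
    of its first sink, and the distance from its end back to its last one. *)
Lemma linear_weightE p s : has id p ->
  linear_weight e (find id p).+1 (find id (rev p)) s =
  e ((find id p).+1 + find id (rev (p ++ s)))%N *
  \prod_(i < size s | nth false s i) e (find id (rev (p ++ take i s))).+1.
Proof.
elim: s p => [|b s IH] p hp /=; first by rewrite big_ord0 mulr1 cats0.
have hp' : has id (rcons p b) by rewrite has_rcons hp orbT.
have fp : find id (rcons p b) = find id p by rewrite -cats1 find_cat hp.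
have {}IH := IH _ hp'; rewrite fp cat_rcons rev_rcons /= in IH.
rewrite [in RHS]big_mkcond big_ord_recl /= cats0.
have -> : \prod_(i < size s) (if nth false s i
      then e (find id (rev (p ++ b :: take i s))).+1 else 1) =
    \prod_(i < size s | nth false s i) e (find id (rev (rcons p b ++ take i s))).+1.
  by rewrite [RHS]big_mkcond; apply: eq_bigr => i _; rewrite cat_rcons.
by case: b hp' fp IH => _ _ /= ->; rewrite ?mul1r //; ring.
Qed.

Lemma cyclic_weightE j s : has id s ->
  cyclic_weight e j s =
  \prod_(i < size s | nth false s i)
    e (find id (rev (nseq j false ++ take i s) ++ rev (drop i s))).+1.
Proof.
elim: s j => [//|b s IH] j /=.
rewrite big_mkcond big_ord_recl /= cats0 rev_nseq.
case: b => /= hs.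
  pose p := rcons (nseq j false) true.
  have hp : has id p by rewrite has_rcons.
  have fp : find id p = j.
    by rewrite /p -cats1 find_cat has_nseq andbF /= size_nseq addn0.
  have := linear_weightE s hp; rewrite fp rev_rcons /= => ->.
  congr (_ * _).
    congr (e _); rewrite addSn; congr _.+1.
    rewrite find_cat has_nseq andbF size_nseq; congr (_ + _)%N.
    rewrite /p cat_rcons rev_cat find_cat ifT //.
    by rewrite has_rev.
  rewrite [LHS]big_mkcond; apply: eq_bigr => i _; case: ifP => // _.
  by rewrite /p cat_rcons [in RHS]find_cat ifT // has_rev has_cat /= orbT.
rewrite mul1r IH // big_mkcond; apply: eq_bigr => i _; case: ifP => // _.
have E : nseq j.+1 false = rcons (nseq j false) false.
  by rewrite -cats1 -[[:: false]]/(nseq 1 false) -nseqD addn1.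
by rewrite E cat_rcons.
Qed.

Lemma cyclic_weight_rot s : has id s ->
  cyclic_weight e 0 s =
  \prod_(i < size s | nth false s i) e (find id (rev (rot i s))).+1.
Proof.
move/(cyclic_weightE 0) => ->; apply: eq_bigr => i _.
by rewrite /= /rot rev_cat.
Qed.

Lemma nth_rot_mod (T : Type) (c : T) k s i : (k < size s)%N -> (i < size s)%N ->
  nth c (rot k s) i = nth c s ((k + i) %% size s).
Proof.
move=> ks is'; rewrite /rot nth_cat size_drop nth_drop; case: ltnP => ik.
  by rewrite modn_small //; lia.
have -> : (k + i = (i - (size s - k)) + size s)%N by lia.
by rewrite modnDr modn_small ?nth_take //; lia.
Qed.

Definition circ_sector n (S : pred 'I_n) (s : 'I_n) : {set 'I_n} :=
  [set v | [exists k : 'I_n, (v == iter k (@ord_pred n) s) &&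
     [forall j : 'I_n, (0 < j <= k)%N ==> ~~ S (iter j (@ord_pred n) s)]]].

Lemma val_iter_ord_pred n (s : 'I_n) k : (k <= n)%N ->
  iter k (@ord_pred n) s = ((s + (n - k)) %% n)%N :> nat.
Proof.
have n0 : (0 < n)%N by case: n s => [[]//|].
elim: k => [|k IH] kn /=; first by rewrite subn0 modnDr modn_small.
rewrite IH 1?ltnW // -subn1.
apply/eqP; rewrite -(eqn_modDr 1) subnK ?addn_gt0 ?n0 ?orbT //.
by rewrite modnDr modn_mod -addnA addn1 subnSK.
Qed.

Lemma iter_ord_pred_inj n (s : 'I_n) :
  injective (fun k : 'I_n => iter k (@ord_pred n) s).
Proof.
have n0 : (0 < n)%N by case: n s => [[]//|].
move=> j k /(congr1 val) /=; rewrite !val_iter_ord_pred; try exact: ltnW.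
move/eqP; rewrite eqn_modDl => /eqP jk; apply: val_inj.
have [j0|j0] := posnP j; have [k0|k0] := posnP k; move: jk.
- by move=> _ /=; rewrite j0 k0.
- by rewrite j0 subn0 modnn modn_small ?ltn_subrL ?n0 //; have := ltn_ord k; lia.
- by rewrite k0 subn0 modnn modn_small ?ltn_subrL ?n0 //; have := ltn_ord j; lia.
- rewrite !modn_small ?ltn_subrL ?n0 ?j0 ?k0 //=.
  by have := ltn_ord k; have := ltn_ord j; lia.
Qed.

(** Rotated to begin at s and then reversed, the list reads s-1, s-2, ... and ends with s itself, so
    the search for the next sink always succeeds. *)
Lemma card_circ_sector n (S : pred 'I_n) s : S s ->
  #|circ_sector S s| = (find id (rev (rot s [seq S i | i <- enum 'I_n]))).+1.
Proof.
move=> Ss; set l := map _ _.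
have sl : size l = n by rewrite size_map size_enum_ord.
set g := rev _; have sg : size g = n by rewrite size_rev size_rot.
have n0 : (0 < n)%N by case: (n) (s) => [[]//|].
have gE j : (j < n)%N -> nth false g j = S (iter j.+1 (@ord_pred n) s).
  move=> jn; rewrite nth_rev ?size_rot ?sl // nth_rot_mod ?sl ?ltn_subrL //.
  rewrite (nth_map s) ?size_enum_ord ?ltn_pmod //; congr (S _).
  by apply: val_inj; rewrite [LHS]nth_enum_ord ?ltn_pmod // [RHS]val_iter_ord_pred.
have fg : (find id g < n)%N.
  rewrite -sg -has_find; apply/(has_nthP false); exists n.-1.
    by rewrite sg prednK.
  rewrite gE prednK // (_ : iter n _ s = s) //; apply: val_inj.
  by rewrite /= val_iter_ord_pred // subnn addn0 modn_small.
have iter_inj := @iter_ord_pred_inj _ s.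
have -> : circ_sector S s =
    [set iter (nat_of_ord k) (@ord_pred n) s | k in [pred k : 'I_n | k <= find id g]%N].
  apply/setP => v; rewrite inE; apply/existsP/imsetP => [[k /andP[/eqP -> /forallP H]]|].
    exists k => //; rewrite inE leqNgt; apply/negP => fk.
    have := H (Ordinal (leq_ltn_trans fk (ltn_ord k))); rewrite /= fk /=.
    have hg : has id g by rewrite has_find sg.
    by rewrite -iterS -gE //; have /= -> := nth_find false hg.
  case=> k; rewrite inE => kf ->; exists k; rewrite eqxx; apply/forallP => -[j jn] /=.
  apply/implyP => /andP[j0 jk]; case: j j0 jk jn => // j _ jk jn.
  rewrite -gE ?(ltnW jn) //.
  by have := before_find false (leq_trans jk kf) => /= ->.
rewrite card_imset // -sum1_card.
transitivity (\sum_(k < n | (k < (find id g).+1)%N) 1)%N; first exact: eq_bigl.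
by rewrite -(big_ord_widen n (fun=> 1%N)) // sum_nat_const card_ord muln1.
Qed.

Lemma sector_weight n (S : pred 'I_n) : (exists s, S s) ->
  \prod_(s | S s) e #|circ_sector S s| =
  cyclic_weight e 0 [seq S i | i <- enum 'I_n].
Proof.
move=> [s Ss]; rewrite cyclic_weight_rot; last first.
  by apply/hasP; exists true => //; apply/mapP; exists s; rewrite ?mem_enum.
rewrite size_map size_enum_ord; apply: eq_big => [i|i Si].
  by rewrite (nth_map i) ?size_enum_ord ?ltn_ord // nth_ord_enum.
by rewrite card_circ_sector.
Qed.

End Sectors.

(** * Acyclicity through height functions *)

Section Acyclic.
Variable V : finType.
Implicit Types theta : {set V * V}.

Lemma rank_acyclic theta (f : V -> nat) :
  (forall u v, (u, v) \in theta -> f u < f v)%N -> acyclic theta.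
Proof.
move=> inc; apply/forallP => u; apply/forallP => v; apply/implyP => uv.
have mono p x : path (orient theta) x p -> (f x <= f (last x p))%N.
  elim: p x => //= y p IH x /andP[xy /IH]; exact/leq_trans/ltnW/inc.
apply/connectP => -[p /mono + uE]; rewrite -uE leqNgt.
by rewrite inc.
Qed.

(** The height of v is the number of vertices that reach v; it grows along an edge from u to v
    because v does not reach u. *)
Lemma acyclic_rank theta : acyclic theta ->
  exists f : V -> nat, forall u v, (u, v) \in theta -> (f u < f v)%N.
Proof.
move=> ac; exists (fun v => #|[pred u | connect (orient theta) u v]|) => u v uv.
apply: proper_card; apply/properP; split.
  by apply/subsetP => z; rewrite !inE => zu; apply: connect_trans zu (connect1 uv).
exists v; rewrite !inE ?connect0 //.
by have /forallP/(_ u)/forallP/(_ v)/implyP/(_ uv) := ac.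
Qed.

Lemma acyclic_sink theta (v0 : V) : acyclic theta -> exists s, sink theta s.
Proof.
case/acyclic_rank => f inc; have [s _ smax] := @arg_maxnP V v0 predT f isT.
exists s; apply/forallP => v; apply/negP => /inc.
by rewrite ltnNge; have /= -> := smax v isT.
Qed.

Lemma orientation_flip (E : rel V) theta u v :
  is_orientation E theta -> adjacent E u v ->
  ((v, u) \in theta) = ((u, v) \notin theta).
Proof.
move=> /forallP/(_ u)/forallP/(_ v) + uv; rewrite uv /orient.
by case: ((u, v) \in theta); case: ((v, u) \in theta).
Qed.

Lemma orientation_adjacent (E : rel V) theta u v :
  is_orientation E theta -> (u, v) \in theta -> adjacent E u v.
Proof.
move=> /forallP/(_ u)/forallP/(_ v) + uv; rewrite /orient uv.
by case: ifP.
Qed.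

End Acyclic.

(** * Orientations of paths and cycles as bit words *)

Section BitOrientations.
Variables (n : nat) (P : pred 'I_n) (E : rel 'I_n).
Hypothesis EP : forall u v, E u v = P u && (v == ordS u).
Hypothesis noloop : forall u, P u -> ordS u != u.
Implicit Types (t : n.-tuple bool) (theta : {set 'I_n * 'I_n}).

Definition bits_orientation t : {set 'I_n * 'I_n} :=
  [set p | [&& P p.1, p.2 == ordS p.1 & tnth t p.1] ||
           [&& P p.2, p.1 == ordS p.2 & ~~ tnth t p.2]].

Definition orientation_bits theta : n.-tuple bool :=
  [tuple P u && ((u, ordS u) \in theta) | u < n].

(** Bits of vertices without an outgoing edge are pinned to 0, which makes words and orientations
    correspond one to one; the height function expresses acyclicity. *)
Definition valid_bits t : Prop :=
  (forall u, tnth t u -> P u) /\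
  exists f : 'I_n -> nat, forall u, P u ->
    if tnth t u then (f u < f (ordS u))%N else (f (ordS u) < f u)%N.

Lemma adjacent_ordS u : P u -> adjacent E u (ordS u).
Proof. by move=> Pu; rewrite /adjacent eq_sym noloop // EP Pu eqxx. Qed.

Lemma adjacentC u v : adjacent E u v = adjacent E v u.
Proof. by rewrite /adjacent eq_sym orbC. Qed.

Lemma orientation_bitsK theta : is_orientation E theta ->
  bits_orientation (orientation_bits theta) = theta.
Proof.
move=> ot; apply/setP => -[u v]; rewrite inE /= !tnth_mktuple.
apply/orP/idP => [[/and3P[_ /eqP -> /andP[]]//|/and3P[Pv /eqP ->]]|uv].
  by rewrite Pv /= -(orientation_flip ot) ?adjacent_ordS.
have := orientation_adjacent ot uv; rewrite /adjacent !EP.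
case/andP=> _ /orP[/andP[Pu /eqP vE]|/andP[Pv /eqP uE]]; subst.
  by left; rewrite Pu eqxx uv.
by right; rewrite Pv eqxx /= -(orientation_flip ot) // adjacent_ordS.
Qed.

Lemma in_bits_orientation t u : valid_bits t -> P u ->
  (((u, ordS u) \in bits_orientation t) = tnth t u) *
  (((ordS u, u) \in bits_orientation t) = ~~ tnth t u).
Proof.
move=> [_ [f inc]] Pu; rewrite !inE /= Pu eqxx /=.
(* On the cycle with two vertices both bits describe the same undirected edge, and the height
   function forces them to be opposite. *)
have flip : [&& P (ordS u) & u == ordS (ordS u)] -> tnth t (ordS u) = ~~ tnth t u.
  case/andP=> PS /eqP uE; move: (inc _ Pu) (inc _ PS); rewrite -uE.
  by case: (tnth t u); case: (tnth t (ordS u)) => //= a b; move: (ltn_trans a b);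
    rewrite ltnn.
rewrite !andbA; move: flip.
by case: (P _ && _) => [/(_ isT) ->|_]; split; case: (tnth t u).
Qed.

Lemma bits_orientation_AO t : valid_bits t -> bits_orientation t \in AO E.
Proof.
move=> vt; have [tP [f inc]] := vt; rewrite inE; apply/andP; split.
  apply/forallP => u; apply/forallP => v; rewrite /orient; case: ifP.
    rewrite /adjacent !EP.
    by case/andP=> _ /orP[/andP[Pu /eqP ->]|/andP[Pv /eqP ->]];
      rewrite !in_bits_orientation //; case: (tnth _ _).
  move/negbT => nuv; rewrite inE /=; apply/norP; split;
    apply: contra nuv => /and3P[Pu /eqP -> _]; rewrite ?adjacent_ordS //.
  by rewrite adjacentC adjacent_ordS.
apply: (rank_acyclic (f := f)) => u v; rewrite inE /=.
case/orP=> /and3P[Pu /eqP -> tu]; have := inc _ Pu; first by rewrite tu.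
by rewrite (negbTE tu).
Qed.

Lemma bits_orientationK t : valid_bits t ->
  orientation_bits (bits_orientation t) = t.
Proof.
move=> vt; apply: eq_from_tnth => u; rewrite tnth_mktuple.
have [Pu|Pu] := boolP (P u); first by rewrite in_bits_orientation.
by apply/esym/negbTE; apply: contra Pu; case: vt => tP _; exact: tP.
Qed.

Lemma AO_valid_bits theta : theta \in AO E -> valid_bits (orientation_bits theta).
Proof.
rewrite inE => /andP[ot /acyclic_rank[f inc]].
split=> [u|]; first by rewrite tnth_mktuple => /andP[].
exists f => u Pu; rewrite tnth_mktuple Pu /=; case: ifPn => [/inc //|].
by rewrite -(orientation_flip ot) ?adjacent_ordS // => /inc.
Qed.

Lemma asc_bits_orientation t : valid_bits t ->
  asc_orientation E (bits_orientation t) = count id t.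
Proof.
move=> vt; rewrite /asc_orientation -sum1_count big_tuple sum1_card.
rewrite -(card_imset _ (f := fun u : 'I_n => (u, ordS u))); last by move=> u v [].
congr #|pred_of_set _|; apply/setP => -[u v]; rewrite inE /= EP.
apply/andP/imsetP => [[/andP[Pu /eqP ->]]|[z tz [-> ->]]].
  by rewrite /orient in_bits_orientation // => tu; exists u.
have Pz : P z by case: vt => tP _; exact: tP.
by rewrite Pz eqxx /orient in_bits_orientation.
Qed.

Lemma sink_bits_orientation t u : valid_bits t ->
  sink (bits_orientation t) u =
  ~~ tnth t u && (P (ord_pred u) ==> tnth t (ord_pred u)).
Proof.
move=> vt; apply/forallP/andP => [H|[tu tp] v].
  split; [apply/negP => tu|apply/implyP => Pp].
    have Pu : P u by case: vt => tP _; exact: tP.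
    by have := H (ordS u); rewrite /orient in_bits_orientation // tu.
  have := H (ord_pred u); rewrite /orient -[X in (X, _) \in _](ord_predK u).
  by rewrite in_bits_orientation // negbK.
rewrite /orient inE /= (negbTE tu) !andbF /=; apply/and3P => -[Pv /eqP uE].
by move: tp; rewrite uE ordSK Pv /= => ->.
Qed.

Lemma sum_AO_bits (R : nmodType) (G : {set 'I_n * 'I_n} -> R) (valid : pred (seq bool)) :
  (forall t, valid t <-> valid_bits t) ->
  \sum_(theta in AO E) G theta = \sum_(t : n.-tuple bool | valid t) G (bits_orientation t).
Proof.
move=> validP; rewrite (reindex_onto bits_orientation orientation_bits) /=; last first.
  by move=> theta; rewrite inE => /andP[/orientation_bitsK].
apply: eq_bigl => t; apply/andP/idP => [[tA /eqP <-]|/validP vt].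
  exact/validP/AO_valid_bits.
by rewrite bits_orientation_AO // bits_orientationK.
Qed.

End BitOrientations.

Lemma val_ord_pred n (u : 'I_n) :
  ord_pred u = (if (u == 0 :> nat)%N then n.-1 else u.-1) :> nat.
Proof.
have := ltn_ord u; rewrite /=; case: eqP => [-> n0|u0 un].
  by rewrite add0n modn_small // prednK.
have -> : ((u + n).-1 = u.-1 + n)%N by lia.
by rewrite modnDr modn_small //; lia.
Qed.

(** * Sums over orientations of paths and cycles *)

Section PathCycle.
Variables (A : comNzRingType) (q : A) (e : nat -> A).

Definition orientation_sum n (E : rel 'I_n) : A :=
  \sum_(theta in AO E) q ^+ asc_orientation E theta *
    \prod_(s | sink theta s) e #|circ_sector (sink theta) s|.

(** [first] supplies the bit before the first vertex: on a cycle that of the last vertex; on a path,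
    where no edge enters the first vertex, the value 1, which makes this vertex a sink exactly when
    its own bit is 0. *)
Lemma orientation_sum_bits n (P : pred 'I_n) (E : rel 'I_n)
    (valid : pred (seq bool)) (first : seq bool -> bool) :
  (0 < n)%N ->
  (forall u v, E u v = P u && (v == ordS u)) ->
  (forall u, P u -> ordS u != u) ->
  (forall t : n.-tuple bool, valid t <-> valid_bits P t) ->
  (forall (t : n.-tuple bool) (u : 'I_n), valid t ->
     (P (ord_pred u) ==> tnth t (ord_pred u)) = nth false (first t :: t) u) ->
  orientation_sum E =
  \sum_(t : n.-tuple bool | valid t)
     q ^+ count id t * cyclic_weight e 0 (sinks_of_bits (first t) t).
Proof.
move=> n0 EP noloop validP firstP.
rewrite /orientation_sum (sum_AO_bits EP noloop _ validP); apply: eq_bigr => t vt.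
have vb := (validP t).1 vt.
rewrite (asc_bits_orientation EP vb); congr (_ * _).
have := bits_orientation_AO EP noloop vb; rewrite inE => /andP[_].
move/(acyclic_sink (Ordinal n0)) => /sector_weight ->; congr (cyclic_weight _ _ _).
apply: (@eq_from_nth _ false) => [|i].
  by rewrite size_map size_enum_ord size_pairmap size_tuple.
rewrite size_map size_enum_ord => i_n; pose u := Ordinal i_n.
rewrite (nth_map u) ?size_enum_ord // (nth_pairmap false) ?size_tuple //.
have -> : nth u (enum 'I_n) i = u by rewrite -[i in LHS]/(nat_of_ord u) nth_ord_enum.
by rewrite (sink_bits_orientation _ vb) (firstP _ _ vt) andbC (tnth_nth false).
Qed.

(** The height rises by [a] at a 1 and falls by [b] at a 0, the offset [b * size t] keeping it a
    natural number. On a cycle [a] is the number of 0s and [b] that of 1s, so that the total change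
    around the circle is zero. *)
Definition bits_height (a b : nat) (t : seq bool) (i : nat) : nat :=
  a * count id (take i t) + b * (size t - count negb (take i t)).

Lemma bits_heightS a b t i : (i < size t)%N ->
  (bits_height a b t i.+1 + (~~ nth false t i) * b =
   bits_height a b t i + nth false t i * a)%N.
Proof.
move=> it; rewrite /bits_height (take_nth false) // -!cats1 !count_cat /= !addn0.
have : (count negb (take i t) <= i)%N.
  by apply: leq_trans (count_size _ _) _; rewrite size_take it.
case: (nth false t i) => /= le; first by rewrite mul0n mul1n !addn0; ring.
set c := count negb _ in le *; have -> : (size t - c = (size t - (c + 1)).+1)%N by lia.
by rewrite mulnS; lia.
Qed.

Lemma orientation_sum_path n (E : rel 'I_n) :
  (0 < n)%N -> (forall u v, E u v = (u.+1 < n)%N && (v == ordS u)) ->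
  orientation_sum E = cyclic_sum q e false true 0 n.
Proof.
move=> n0 EP.
have ordSE (u : 'I_n) : (u.+1 < n)%N -> ordS u = u.+1 :> nat by move/modn_small.
rewrite (orientation_sum_bits (P := fun u : 'I_n => (u.+1 < n)%N)
  (valid := fun s => ~~ last true s) (first := fun=> true)) //.
- by rewrite big_mkcond; apply: eq_bigr => t _; rewrite eqbF_neg; case: ifP;
    rewrite ?mulr0.
- by move=> u un; apply/eqP => /(congr1 val); rewrite /= modn_small //; lia.
- move=> t; have lastE : last true t = nth true t n.-1 by rewrite -nth_last size_tuple.
  split=> [lt|[tP _]].
    split=> [u tu|].
      rewrite ltn_neqAle ltn_ord andbT; apply: contra lt => /eqP un.
      have un' : n.-1 = u by lia.
      by rewrite lastE un' -tnth_nth.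
    exists (bits_height 1 1 t) => u un; rewrite ordSE // (tnth_nth false).
    have := @bits_heightS 1 1 t u; rewrite size_tuple ltn_ord => /(_ isT).
    by case: (nth false t u) => /=; rewrite !(addn0, muln1) => H; lia.
  rewrite lastE; apply/negP => tn.
  have pn : (n.-1 < n)%N by rewrite prednK.
  have := tP (Ordinal pn); rewrite (tnth_nth true) /= prednK // ltnn.
  by move/(_ tn).
move=> t u lt; rewrite (tnth_nth false) val_ord_pred; case: eqP => [-> /=|u0].
  by rewrite prednK // ltnn.
have -> : nat_of_ord u = u.-1.+1 by lia.
by rewrite /= (_ : (u.-1.+1 < n)%N) //; have := ltn_ord u; lia.
Qed.

Lemma cyclic_weight_nosink j s : ~~ has id s -> cyclic_weight e j s = 0.
Proof. by elim: s j => //= -[] s IH j //; apply: IH. Qed.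

Lemma sinks_const c s : all (pred1 c) s -> ~~ has id (sinks_of_bits c s).
Proof. by elim: s => //= b s IH /andP[/eqP -> /IH]; case: c {IH}. Qed.

Lemma orientation_sum_cycle n (E : rel 'I_n) :
  (1 < n)%N -> (forall u v, E u v = (v == ordS u)) ->
  orientation_sum E = cyclic_sum q e true true 0 n + cyclic_sum q e false false 0 n.
Proof.
move=> n1 EP; have n0 := ltnW n1.
have noloop (u : 'I_n) : ordS u != u.
  apply/eqP => /(congr1 val) /=.
  have := ltn_ord u; rewrite leq_eqVlt => /orP[/eqP un|un].
    by rewrite un modnn => u0; rewrite -u0 in un; rewrite -un in n1.
  by rewrite modn_small // => /eqP; rewrite eqn_leq ltnn.
rewrite (orientation_sum_bits (P := predT)
  (valid := fun s => has id s && has negb s) (first := last true)) //.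
- rewrite /cyclic_sum /bit_sum -big_split big_mkcond; apply: eq_bigr => t _ /=.
  have [b [s ts]] : exists b, exists s, t = b :: s :> seq bool.
    by case: t => -[|b s] //= st; [rewrite -(eqP st) in n0|exists b, s].
  have lE p : last p t = last b s by rewrite ts.
  rewrite -mulrDr !lE.
  have -> : (if last b s == true then cyclic_weight e 0 (sinks_of_bits true t) else 0) +
      (if last b s == false then cyclic_weight e 0 (sinks_of_bits false t) else 0) =
      cyclic_weight e 0 (sinks_of_bits (last b s) t).
    by case: (last b s); rewrite ?addr0 ?add0r.
  case: ifPn => // nc; rewrite cyclic_weight_nosink ?mulr0 //.
  have [c ct] : exists c, all (pred1 c) t.
    move: nc; rewrite negb_and -!all_predC => /orP[nc|nc]; [exists false|exists true];
      by apply: sub_all nc => -[].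
  suff -> : last b s = c by exact: sinks_const.
  by move: ct; rewrite ts => /allP/(_ _ (mem_last b s))/eqP.
- move=> t; split=> [/andP[h1 h2]|[_ [f inc]]].
    split=> //; exists (bits_height (count negb t) (count id t) t) => u _.
    have := @bits_heightS (count negb t) (count id t) t u.
    rewrite size_tuple ltn_ord => /(_ isT); rewrite (tnth_nth false).
    have -> : bits_height (count negb t) (count id t) t (ordS u) =
              bits_height (count negb t) (count id t) t u.+1.
      have := ltn_ord u; rewrite leq_eqVlt => /orP[/eqP un|un]; last first.
        by rewrite /= modn_small.
      rewrite /= un modnn /bits_height take0 /= muln0 subn0 add0n.
      rewrite take_oversize ?size_tuple // [X in (X + _)%N]mulnC -mulnDr subnKC //.
      by rewrite -[X in (_ <= X)%N](size_tuple t) count_size.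
    by move: h1 h2; rewrite !has_count; case: (nth false t u) => /=; lia.
  (* A constant word would make the height fall, or rise, at every step around the circle, which
     fails at a minimum or a maximum. *)
  apply/andP; split; apply/negPn/negP; rewrite -all_predC => /all_tnthP H.
    have [u _ umin] := @arg_minnP 'I_n (Ordinal n0) predT f isT.
    have := inc u isT; rewrite (negbTE (H u)) ltnNge.
    by have /= -> := umin (ordS u) isT.
  have [u _ umax] := @arg_maxnP 'I_n (Ordinal n0) predT f isT.
  have := inc u isT; have /= := H u; rewrite negbK => ->; rewrite ltnNge.
  by have /= -> := umax (ordS u) isT.
move=> t u _; rewrite (tnth_nth false) val_ord_pred /=; case: eqP => [->|u0].
  rewrite /= (last_nth false) size_tuple.
  by transitivity (nth false (true :: t) n.-1.+1) => //; congr (nth _ _ _); lia.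
by have -> : nat_of_ord u = u.-1.+1 by lia.
Qed.

End PathCycle.

(** * Complete graphs *)

Section Ranking.
Variables (T : finType) (f : T -> nat).
Hypothesis f_inj : injective f.
Implicit Types J : {set T}.

Definition rank_in J c := #|[set d in J | (f d < f c)%N]|.

Lemma rank_in_lt J c : c \in J -> (rank_in J c < #|J|)%N.
Proof.
move=> cJ; apply: proper_card; apply/properP; split.
  by apply/subsetP => d; rewrite inE => /andP[].
by exists c => //; rewrite inE ltnn andbF.
Qed.

Lemma ltn_rank_in J : {in J &, forall c d, (rank_in J c < rank_in J d)%N = (f c < f d)%N}.
Proof.
have lt c d : c \in J -> d \in J -> (f c < f d)%N -> (rank_in J c < rank_in J d)%N.
  move=> cJ dJ cd; apply: proper_card; apply/properP; split.
    apply/subsetP => b; rewrite !inE => /andP[-> /=] bc.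
    exact: ltn_trans bc cd.
  by exists c; rewrite !inE ?cJ ?ltnn.
move=> c d cJ dJ; case: (ltngtP (f c) (f d)) => [|cd|/f_inj ->]; last by rewrite ltnn.
  exact: lt.
by apply/negbTE; rewrite -leqNgt ltnW // lt.
Qed.

Lemma rank_in_inj J : {in J &, injective (rank_in J)}.
Proof.
move=> c d cJ dJ cd; apply: f_inj; apply/eqP.
by case: (ltngtP (f c) (f d)) => //; rewrite -(ltn_rank_in (J := J)) // cd ltnn.
Qed.

Lemma rank_in_onto J k : (k < #|J|)%N -> exists2 c, c \in J & rank_in J c = k.
Proof.
move=> kJ; pose g (i : 'I_#|J|) := Ordinal (rank_in_lt (enum_valP i)).
have g_inj : injective g.
  move=> i j /(congr1 val) /= /rank_in_inj H; apply: enum_val_inj.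
  by apply: H; exact: enum_valP.
have /codomP[i ki] := injF_onto g_inj (Ordinal kJ).
by exists (enum_val i); [exact: enum_valP|have /(congr1 val) := ki].
Qed.

End Ranking.

Section EdgeWeight.
Variables (A : comNzRingType) (q : A) (C : finType) (rho : C -> nat).

Definition properb (V : finType) (E : rel V) (F : V -> C) :=
  [forall u, forall v, E u v ==> (F u != F v)].

Definition asc_pairs (V : finType) (E : rel V) (F : V -> C) : {set V * V} :=
  [set p | E p.1 p.2 && (rho (F p.1) < rho (F p.2))%N].

Lemma edge_weightE (V : finType) (E : rel V) (F : V -> C) :
  \prod_u \prod_v (if E u v then cmpw q rho (F u) (F v) else 1) =
  if properb E F then q ^+ #|asc_pairs E F| else 0.
Proof.
rewrite pair_big /=; case: ifPn => [/forallP prF|].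
  rewrite -prodr_const [RHS]big_mkcond; apply: eq_bigr => -[u v] _ /=.
  rewrite inE /=; case: ifP => //= uv; rewrite /cmpw.
  by have /forallP/(_ v) := prF u; rewrite uv /= => /negbTE ->.
rewrite negb_forall => /existsP[u]; rewrite negb_forall => /existsP[v].
rewrite negb_imply negbK => /andP[uv /eqP Fuv].
by rewrite (bigD1 (u, v)) //= uv /cmpw Fuv eqxx mul0r.
Qed.

End EdgeWeight.

Section Complete.
Variables (A : comNzRingType) (q : A) (C : finType) (rho : C -> nat).
Hypothesis rho_inj : injective rho.
Variables (x : C -> A) (c0 : C).
Variables (V : finType) (E : rel V).
Hypothesis E_irr : forall u, ~~ E u u.
Hypothesis E_complete : forall u v, adjacent E u v = (u != v).

Definition induced_orientation (F : V -> C) : {set V * V} :=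
  [set p | (rho (F p.1) < rho (F p.2))%N].

Lemma properb_complete (F : V -> C) : reflect (injective F) (properb E F).
Proof.
apply: (iffP forallP) => [H u v Fuv|Finj u].
  apply/eqP; have := E_complete u v; rewrite /adjacent.
  case: eqVneq => //= _ /orP[uv|uv].
    by have /forallP/(_ v) := H u; rewrite uv Fuv eqxx.
  by have /forallP/(_ u) := H v; rewrite uv Fuv eqxx.
apply/forallP => v; apply/implyP => uv; apply/eqP => /Finj uE.
by rewrite uE (negbTE (E_irr v)) in uv.
Qed.

Lemma induced_orientation_AO (F : V -> C) : injective F -> induced_orientation F \in AO E.
Proof.
move=> Finj; rewrite inE; apply/andP; split.
  apply/forallP => u; apply/forallP => v; rewrite E_complete /orient !inE /=.
  case: eqVneq => [->|uv] /=; first by rewrite ltnn.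
  case: (ltngtP (rho (F u)) (rho (F v))) => // /rho_inj/Finj uE.
  by rewrite uE eqxx in uv.
by apply: (rank_acyclic (f := rho \o F)) => u v; rewrite inE.
Qed.

Section Fibre.
Variable theta : {set V * V}.
Hypothesis theta_AO : theta \in AO E.

Lemma complete_rank : exists f : V -> nat,
  injective f /\ forall u v, ((u, v) \in theta) = (f u < f v)%N.
Proof.
move: theta_AO; rewrite inE => /andP[ot /acyclic_rank[f inc]].
have tot u v : u != v -> ((v, u) \in theta) = ((u, v) \notin theta).
  by move=> uv; apply: (orientation_flip ot); rewrite E_complete.
exists f; split=> [u v fuv|u v].
  apply/eqP/negPn/negP => uv; have := tot u v uv.
  case: (boolP ((u, v) \in theta)) => [/inc|_ /inc]; first by rewrite fuv ltnn.
  by rewrite fuv ltnn.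
apply/idP/idP => [/inc //|fuv].
have uv : u != v by apply: contraTneq fuv => ->; rewrite ltnn.
apply/negPn; rewrite -tot //; apply/negP => /inc.
by rewrite ltnNge ltnW.
Qed.

(** In the linear order [theta] the rank of v is its in-degree, so a colouring inducing [theta] with
    value set J must give v the colour of that rank in J. The default [c0] is not reached when J and
    V have the same size. *)
Definition fibre_colouring (J : {set C}) : {ffun V -> C} :=
  [ffun v => odflt c0
    [pick c in J | rank_in rho J c == #|[set u | (u, v) \in theta]|]].

Lemma complete_fibre_sum :
  \sum_(F : {ffun V -> C} | properb E F && (induced_orientation F == theta))
     \prod_v x (F v) = elsym x #|V|.
Proof.
have [f [f_inj fE]] := complete_rank.
have rE v : #|[set u | (u, v) \in theta]| = rank_in f [set: V] v.
  by apply: eq_card => u; rewrite !inE fE.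
have fcP (J : {set C}) v : #|J| = #|V| ->
    fibre_colouring J v \in J /\
    rank_in rho J (fibre_colouring J v) = rank_in f [set: V] v.
  move=> JV; rewrite /fibre_colouring ffunE rE; case: pickP => /=.
    by move=> c /andP[cJ /eqP].
  have : (rank_in f [set: V] v < #|J|)%N by rewrite JV -cardsT; apply: rank_in_lt.
  by case/(rank_in_onto rho_inj) => c cJ rc /(_ c); rewrite cJ rc eqxx.
have fc_inj (J : {set C}) : #|J| = #|V| -> injective (fibre_colouring J).
  move=> JV u v uv; have [_ ru] := fcP J u JV; have [_ rv] := fcP J v JV.
  by apply: (@rank_in_inj _ _ f_inj [set: V]); rewrite ?inE // -ru -rv uv.
rewrite (reindex_onto fibre_colouring (fun F : {ffun V -> C} => F @: [set: V])) /=.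
  apply: eq_big => [J|J].
    apply/andP/eqP => [[/andP[/properb_complete Finj _] /eqP <-]|JV].
      by rewrite card_imset // cardsT.
    split; first (apply/andP; split).
    - exact/properb_complete/fc_inj.
    - apply/eqP/setP => -[u v]; rewrite inE /= fE.
      have [uJ ru] := fcP J u JV; have [vJ rv] := fcP J v JV.
      by rewrite -(ltn_rank_in rho_inj uJ vJ) ru rv (ltn_rank_in f_inj) ?inE.
    rewrite eqEcard card_imset ?cardsT ?JV ?leqnn ?andbT; last exact: fc_inj.
    by apply/subsetP => _ /imsetP[v _ ->]; have [] := fcP J v JV.
  case/andP=> /andP[/properb_complete Finj _] /eqP JE.
  rewrite -[in RHS]JE big_imset /=; last by move=> u v _ _ /Finj.
  by apply: eq_bigl => v; rewrite inE.
move=> F /andP[/properb_complete Finj /eqP Fth].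
have JV : #|F @: [set: V]| = #|V| by rewrite card_imset // cardsT.
apply/ffunP => v; have [cJ rc] := fcP _ v JV.
apply: (rank_in_inj rho_inj cJ); first exact: imset_f.
rewrite rc -rE -[LHS](card_imset _ Finj); apply: eq_card => c.
rewrite inE; apply/imsetP/andP => [[u + ->]|[/imsetP[u _ ->] lt]].
  by rewrite inE -Fth inE /= => lt; rewrite imset_f.
by exists u => //; rewrite inE -Fth inE.
Qed.
End Fibre.

Lemma colouring_sum_complete :
  colouring_sum q rho x E =
  (\sum_(theta in AO E) q ^+ asc_orientation E theta) * elsym x #|V|.
Proof.
rewrite /colouring_sum.
under eq_bigr => F _ do rewrite edge_weightE.
rewrite (bigID (fun F : {ffun V -> C} => properb E F)) /= addrC.
rewrite big1 ?add0r => [|F /negbTE ->]; last by rewrite mulr0.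
rewrite (partition_big (fun F : {ffun V -> C} => induced_orientation F) (mem (AO E))) /=.
  rewrite mulr_suml; apply: eq_bigr => theta tA.
  rewrite -(complete_fibre_sum tA) mulr_sumr; apply: eq_bigr => F /andP[-> /eqP <-].
  rewrite mulrC; congr (q ^+ _ * _); apply: eq_card => p; rewrite !inE.
  by rewrite /orient inE.
by move=> F /properb_complete; exact: induced_orientation_AO.
Qed.

End Complete.

Section CompleteOrientations.
Variables (A : comNzRingType) (q : A) (e : nat -> A).

(** An acyclic orientation of a complete graph is a linear order: its top vertex is the only sink,
    and the sector runs around the whole circle. *)
Lemma orientation_sum_complete n (E : rel 'I_n) : (0 < n)%N ->
  (forall u v, adjacent E u v = (u != v)) ->
  orientation_sum q e E = (\sum_(theta in AO E) q ^+ asc_orientation E theta) * e n.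
Proof.
move=> n0 Ec; rewrite /orientation_sum mulr_suml; apply: eq_bigr => theta tA.
congr (_ * _); have [f [f_inj fE]] := complete_rank Ec tA.
have [s sS] : exists s, sink theta s.
  by move: tA; rewrite inE => /andP[_ /(acyclic_sink (Ordinal n0))].
have uS u : sink theta u -> u = s.
  move=> /forallP/(_ s); have /forallP/(_ u) := sS.
  by rewrite /orient !fE; case: ltngtP => // /f_inj.
rewrite (big_pred1 s) => [|u]; last first.
  by rewrite /=; apply/idP/eqP => [/uS|->].
congr (e _); rewrite -[RHS]card_ord -cardsT.
rewrite -(card_imset _ (@iter_ord_pred_inj _ s)).
apply: eq_card => v; rewrite inE; apply/existsP/imsetP => [[k /andP[/eqP -> _]]|].
  by exists k.
case=> k _ ->; exists k; rewrite eqxx; apply/forallP => j.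
apply/implyP => /andP[j0 _]; apply/negP => /uS.
rewrite -[RHS]/(iter (Ordinal n0) (@ord_pred n) s) => /iter_ord_pred_inj jE.
by rewrite jE in j0.
Qed.

End CompleteOrientations.

(** * Disjoint unions *)

Section Components.
Variables (A : comNzRingType) (q : A) (C : finType) (rho : C -> nat).
Hypothesis rho_inj : injective rho.
Variables (x : C -> A) (c0 : C).

Lemma circ_edge_path n (u v : 'I_n) :
  circ_edge (path_arcs n) u v = (u.+1 < n)%N && (v == ordS u).
Proof.
rewrite /circ_edge /path_arcs ffunE; case: ifP => //= _.
by rewrite orbF addn1.
Qed.

Lemma circ_edge_cycle n (u v : 'I_n) :
  circ_edge (cycle_arcs n) u v = (v == ordS u).
Proof. by rewrite /circ_edge /cycle_arcs ffunE /= orbF addn1. Qed.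

Lemma circ_edge_complete n (u v : 'I_n) :
  circ_edge (complete_arcs n) u v = (u < v)%N.
Proof.
rewrite /circ_edge /complete_arcs ffunE.
have un := ltn_ord u; have vn := ltn_ord v.
apply/hasP/idP => [[k]|uv].
  by rewrite mem_iota => kn /eqP ->; rewrite modn_small; lia.
exists (v - u)%N; first by rewrite mem_iota; lia.
by rewrite subnKC ?modn_small // ltnW.
Qed.

Lemma circ_edge_bidirected n (u v : 'I_n) :
  circ_edge (bidirected_arcs n) u v = (u != v).
Proof.
rewrite /circ_edge /bidirected_arcs ffunE.
have un := ltn_ord u; have vn := ltn_ord v.
apply/hasP/idP => [[k]|uv].
  rewrite mem_iota => kn /eqP vE; apply/eqP => uv; move: vE; rewrite -uv.
  have [lt|ge] := ltnP (u + k) n; first by rewrite modn_small //; lia.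
  have -> : (u + k = (u + k - n) + n)%N by lia.
  by rewrite modnDr modn_small; lia.
have {}uv : u != v :> nat by [].
have [lt|ge] := ltnP u v.
  exists (v - u)%N; first by rewrite mem_iota; lia.
  by rewrite subnKC ?modn_small // ltnW.
exists (v + n - u)%N; first by rewrite mem_iota; lia.
have -> : (u + (v + n - u) = v + n)%N by lia.
by rewrite modnDr modn_small.
Qed.

Lemma component_sum n (a : {ffun 'I_n -> nat}) : is_PCKB a ->
  colouring_sum q rho x (circ_edge a) = orientation_sum q (elsym x) (circ_edge a).
Proof.
have complete (E : rel 'I_n) : (0 < n)%N -> (forall u, ~~ E u u) ->
    (forall u v, adjacent E u v = (u != v)) ->
    colouring_sum q rho x E = orientation_sum q (elsym x) E.
  move=> n0 E_irr Ec.
  by rewrite (colouring_sum_complete q rho_inj x c0 E_irr Ec) card_ord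
     orientation_sum_complete.
case=> -[n0 ->].
- have EP := @circ_edge_path n.
  rewrite (orientation_sum_path _ _ n0 EP) (colouring_sum_path _ _ _ EP n0).
  by case: (n) n0 => // m _; exact: path_sum_bits.
- have EP := @circ_edge_cycle n.
  rewrite (orientation_sum_cycle _ _ n0 EP) (colouring_sum_cycle _ _ _ EP (ltnW n0)).
  by case: (n) n0 => // m _; exact: cycle_sum_bits.
- apply: complete => // [u|u v]; first by rewrite circ_edge_complete ltnn.
  by rewrite /adjacent !circ_edge_complete -neq_ltn andbb.
apply: complete => // [u|u v]; first by rewrite circ_edge_bidirected eqxx.
by rewrite /adjacent !circ_edge_bidirected (eq_sym v) orbb andbb.
Qed.

End Components.

Section FProdDistr.
Variables (A : comNzRingType) (I : finType) (T_ : I -> finType).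

(** The vertex types of the components differ, so a choice in each component is a dependent
    function; tagging its values reduces the claim to ordinary distributivity. *)
Lemma bigA_distr_fprod (P_ : forall i, T_ i -> A) :
  \prod_i \sum_(j : T_ i) P_ i j = \sum_(t : fprod T_) \prod_i P_ i (t i).
Proof.
pose P i : {ffun T_ i -> A} := [ffun j => P_ i j].
transitivity (\sum_(t : fprod T_) \prod_i P i (t i)); last first.
  by apply: eq_bigr => t _; apply: eq_bigr => i _; rewrite ffunE.
rewrite big_fprod -(bigA_distr_big_dep (fun i => tagged_with T_ i)
  (fun i => untag 0 (P i))); apply: eq_bigr => i _.
by rewrite -(big_tag (fun i j => P i j)); apply: eq_bigr => j _; rewrite ffunE.
Qed.

End FProdDistr.

Section Union.
Variables (A : comNzRingType) (q : A) (r : nat) (n : 'I_r -> nat).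
Variable a : forall i, {ffun 'I_(n i) -> nat}.
Local Notation V := (union_vertex n).
Local Notation T := (fun i : 'I_r => 'I_(n i)).
Local Notation E := (union_edge a).

Lemma prod_union (F : V -> A) : \prod_v F v = \prod_i \prod_(u : 'I_(n i)) F (Tagged T u).
Proof.
rewrite (sig_big_dep _ (fun=> predT) (fun i u => F (Tagged T u))) /=.
by apply: eq_bigr => -[i u].
Qed.

Lemma prod_union2 (F : V -> V -> A) :
  (forall u v, tag u != tag v -> F u v = 1) ->
  \prod_u \prod_v F u v =
  \prod_i \prod_(u : 'I_(n i)) \prod_(v : 'I_(n i)) F (Tagged T u) (Tagged T v).
Proof.
move=> F1; rewrite prod_union; apply: eq_bigr => i _; apply: eq_bigr => u _.
rewrite prod_union (bigD1 i) //= [X in _ * X]big1 ?mulr1 // => j ji.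
by apply: big1 => v _; apply: F1; rewrite eq_sym.
Qed.

Lemma union_edge_same i (u v : 'I_(n i)) :
  E (Tagged T u) (Tagged T v) = circ_edge (a i) u v.
Proof. by rewrite /union_edge /= eqxx tagged_asE. Qed.

Lemma union_edge_diff (u v : V) : tag u != tag v -> E u v = false.
Proof. by rewrite /union_edge => /negbTE ->. Qed.

Lemma colouring_sum_union (C : finType) (rho : C -> nat) (x : C -> A) :
  colouring_sum q rho x E = \prod_i colouring_sum q rho x (circ_edge (a i)).
Proof.
rewrite /colouring_sum bigA_distr_fprod.
pose h (t : fprod (fun i : 'I_r => {ffun 'I_(n i) -> C})) : {ffun V -> C} :=
  [ffun v => t (tag v) (tagged v)].
pose h' (F : {ffun V -> C}) : fprod (fun i : 'I_r => {ffun 'I_(n i) -> C}) :=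
  fprod_of_fun (fun i => [ffun u => F (Tagged T u)]).
rewrite (reindex h) /=; last first.
  exists h' => [t _|F _].
    by apply/fprodP => i; rewrite fprodE; apply/ffunP => u; rewrite !ffunE.
  by apply/ffunP => -[i u]; rewrite ffunE fprodE ffunE.
apply: eq_bigr => t _; rewrite prod_union prod_union2; last first.
  by move=> u v uv; rewrite union_edge_diff.
rewrite -big_split; apply: eq_bigr => i _; congr (_ * _).
  by apply: eq_bigr => u _; rewrite ffunE.
apply: eq_bigr => u _; apply: eq_bigr => v _.
by rewrite union_edge_same !ffunE.
Qed.

Definition restr (theta : {set V * V}) (i : 'I_r) : {set 'I_(n i) * 'I_(n i)} :=
  [set p | (Tagged T p.1, Tagged T p.2) \in theta].

Definition glue (t : fprod (fun i : 'I_r => {set 'I_(n i) * 'I_(n i)})) :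
    {set V * V} :=
  [set p | (tag p.1 == tag p.2) &&
           ((tagged p.1, tagged_as p.1 p.2) \in t (tag p.1))].

Definition no_cross (theta : {set V * V}) :=
  forall u v, (u, v) \in theta -> tag u = tag v.

Lemma glue_no_cross t : no_cross (glue t).
Proof. by move=> u v; rewrite inE /= => /andP[/eqP]. Qed.

Lemma restr_glue t i : restr (glue t) i = t i.
Proof. by apply/setP => -[u v]; rewrite !inE /= eqxx tagged_asE. Qed.

Lemma adjacent_same i (u v : 'I_(n i)) :
  adjacent E (Tagged T u) (Tagged T v) = adjacent (circ_edge (a i)) u v.
Proof.
rewrite /adjacent !union_edge_same; congr (~~ _ && _).
by rewrite eq_Tagged.
Qed.

Lemma adjacent_diff (u v : V) : tag u != tag v -> adjacent E u v = false.
Proof. by move=> uv; rewrite /adjacent !union_edge_diff ?andbF // eq_sym. Qed.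

Lemma AO_no_cross theta : theta \in AO E -> no_cross theta.
Proof.
rewrite inE => /andP[ot _] u v uv; apply/eqP/negPn/negP => nuv.
by have := orientation_adjacent ot uv; rewrite adjacent_diff.
Qed.

Lemma AO_restr theta i : theta \in AO E -> restr theta i \in AO (circ_edge (a i)).
Proof.
rewrite !inE => /andP[ot /acyclic_rank[f inc]]; apply/andP; split.
  apply/forallP => u; apply/forallP => v.
  have /forallP/(_ (Tagged T u))/forallP/(_ (Tagged T v)) := ot.
  by rewrite adjacent_same /orient !inE.
apply: (rank_acyclic (f := fun u => f (Tagged T u))) => u v; rewrite inE.
exact: inc.
Qed.

Lemma restr_AO theta : no_cross theta ->
  (forall i, restr theta i \in AO (circ_edge (a i))) -> theta \in AO E.
Proof.
move=> nc H; rewrite inE; apply/andP; split.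
  apply/forallP => -[i u]; apply/forallP => -[j v].
  have [ij|ij] := eqVneq i j.
    subst j; have := H i; rewrite inE => /andP[/forallP/(_ u)/forallP/(_ v) + _].
    by rewrite (adjacent_same u v) /orient !inE.
  by rewrite adjacent_diff //; apply/negP => /nc /= /eqP; rewrite (negbTE ij).
(* Heights are chosen in each component separately; no arc joins two components, so they never need
   comparing. *)
have [f inc] : exists f : forall i, 'I_(n i) -> nat,
    forall i u v, (u, v) \in restr theta i -> (f i u < f i v)%N.
  apply: (@fin_all_exists _ _ (fun i f => forall u v, (u, v) \in restr theta i -> (f u < f v)%N)).
  by move=> i; have := H i; rewrite inE => /andP[_ /acyclic_rank].
apply: (rank_acyclic (f := fun v => f (tag v) (tagged v))) => -[i u] [j v] uv.
have /= ij := nc _ _ uv; subst j.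
by apply: inc; rewrite inE.
Qed.

Lemma sum_AO_union (G : forall i, {set 'I_(n i) * 'I_(n i)} -> A) :
  \sum_(theta in AO E) \prod_i G i (restr theta i) =
  \prod_i \sum_(theta in AO (circ_edge (a i))) G i theta.
Proof.
under [RHS]eq_bigr => i _ do rewrite big_mkcond.
rewrite bigA_distr_fprod.
rewrite (reindex_onto glue (fun theta => fprod_of_fun (restr theta))) /=; last first.
  move=> theta tA; apply/setP => -[[i u] [j v]]; rewrite inE /= fprodE.
  apply/andP/idP => [[/eqP ij]|uv]; first by subst j; rewrite tagged_asE inE.
  have /= ij := AO_no_cross tA uv; subst j.
  by rewrite eqxx tagged_asE inE.
rewrite [RHS](bigID (fun t : fprod _ => [forall i, t i \in AO (circ_edge (a i))])) /=.
rewrite [X in _ = _ + X]big1 ?addr0; last first.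
  move=> t; rewrite negb_forall => /existsP[i ti].
  by rewrite (bigD1 i) //= (negbTE ti) mul0r.
apply: eq_big => [t|t /andP[tA _]].
  have -> : fprod_of_fun (restr (glue t)) = t.
    by apply/fprodP => i; rewrite fprodE restr_glue.
  rewrite eqxx andbT; apply/idP/forallP => [tA i|H].
    by rewrite -(restr_glue t); exact: AO_restr.
  by apply: restr_AO => [|i]; [exact: glue_no_cross|rewrite restr_glue].
apply: eq_bigr => i _; have := AO_restr i tA; rewrite restr_glue.
by move=> ->.
Qed.

Lemma asc_orientation_union theta : no_cross theta ->
  q ^+ asc_orientation E theta =
  \prod_i q ^+ asc_orientation (circ_edge (a i)) (restr theta i).
Proof.
have ascE (W : finType) (D : rel W) th : q ^+ asc_orientation D th =
    \prod_u \prod_v (if D u v && ((u, v) \in th) then q else 1).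
  rewrite pair_big /= -prodr_const big_mkcond; apply: eq_bigr => -[u v] _.
  by rewrite inE.
move=> nc; rewrite ascE prod_union2; last first.
  by move=> u v uv; rewrite union_edge_diff.
apply: eq_bigr => i _; rewrite ascE; apply: eq_bigr => u _; apply: eq_bigr => v _.
by rewrite union_edge_same inE.
Qed.

Lemma sink_union theta i (u : 'I_(n i)) : no_cross theta ->
  sink theta (Tagged T u) = sink (restr theta i) u.
Proof.
move=> nc; apply/forallP/forallP => [H v|H [j v]].
  by rewrite /orient inE; exact: H.
apply/negP => uv; have /= ij := nc _ _ uv; subst j.
by have /negP := H v; rewrite /orient inE; apply.
Qed.

Lemma iter_prev_vertex i (u : 'I_(n i)) k :
  iter k (@prev_vertex r n) (Tagged T u) = Tagged T (iter k (@ord_pred (n i)) u).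
Proof. by elim: k => //= k ->. Qed.

Lemma card_sector theta i (u : 'I_(n i)) : no_cross theta ->
  #|sector theta (Tagged T u)| = #|circ_sector (sink (restr theta i)) u|.
Proof.
move=> nc; have Tinj : injective (Tagged T (i := i)).
  by move=> v v' /eqP; rewrite eq_Tagged => /eqP.
rewrite -(card_imset _ Tinj); apply: eq_card => v; rewrite inE.
apply/existsP/imsetP => [[k /andP[/eqP -> /forallP H]]|[w wS ->]].
  exists (iter k (@ord_pred (n i)) u); last by rewrite iter_prev_vertex.
  rewrite inE; apply/existsP; exists k; rewrite eqxx; apply/forallP => j.
  by have := H j; rewrite iter_prev_vertex sink_union.
move: wS; rewrite inE => /existsP[k /andP[/eqP -> /forallP H]].
exists k; rewrite iter_prev_vertex eqxx; apply/forallP => j.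
by have := H j; rewrite iter_prev_vertex sink_union.
Qed.

Lemma orientation_sum_union (e : nat -> A) :
  \sum_(theta in AO E) q ^+ asc_orientation E theta *
     \prod_(s | sink theta s) e #|sector theta s| =
  \prod_i orientation_sum q e (circ_edge (a i)).
Proof.
rewrite /orientation_sum -sum_AO_union; apply: eq_bigr => theta tA.
have nc := AO_no_cross tA.
rewrite asc_orientation_union // [X in _ * X]big_mkcond prod_union -big_split.
apply: eq_bigr => i _; congr (_ * _); rewrite [RHS]big_mkcond.
by apply: eq_bigr => u _; rewrite sink_union // card_sector.
Qed.

End Union.

(** * Coefficients of the series *)

(** An axiom of monomial structures, through which [polyring] becomes a commutative ring where the
    identity over arbitrary rings applies. *)
Lemma monomial_unit (m1 m2 : monomial) :
  (m1 `+` m2)%mset = mset0 -> m1 = mset0 /\ m2 = mset0.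
Proof.
move=> m0; have H i : (m1 i + m2 i = 0)%N by rewrite -msetE2 m0 mset0E.
by split; apply/msetP => i; rewrite mset0E; have := H i; lia.
Qed.

HB.instance Definition _ := Choice_isMonomialDef.Build monomial
  (@msetDA _) (@mset0D _) (@msetD0 _) monomial_unit.
HB.instance Definition _ := MonomialDef_isConomialDef.Build monomial (@msetDC _).

Notation polyring := {malg {poly int}[monomial]}.

Section Truncation.
Variable N : nat.
Local Notation C := 'I_N.+1.

Definition emb (c : C) : posint := exist _ c.+1 (ltn0Sn c).

(** Colour c stands for the variable of index c + 1, so the colours realise exactly the indices up
    to [N.+1]. There is always at least one colour, which serves as the default [c0] in the complete
    case. *)
Definition bounded (m : monomial) : Prop :=
  forall i : posint, i \in m -> (val i <= N.+1)%N.

Definition xvar (c : C) : polyring := << [mset emb c]%mset >>.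

Definition qvar : polyring := 'X%:MP.

Lemma emb_inj : injective emb.
Proof. by move=> c d /(congr1 val) [] /val_inj. Qed.

Lemma embP (i : posint) : (val i <= N.+1)%N -> exists c, emb c = i.
Proof.
case: i => -[|k] //= k0 kN; exists (Ordinal (kN : (k < N.+1)%N)).
exact: val_inj.
Qed.

Lemma malgUM (m1 m2 : monomial) :
  (<< m1 >> * << m2 >> : polyring) = << (m1 `+` m2)%mset >>.
Proof. by rewrite malgM_def fgmulUU mulr1. Qed.

Lemma xvar_prod (s : seq C) :
  \prod_(c <- s) xvar c = << (seq_mset [seq emb c | c <- s] : monomial) >>.
Proof.
elim: s => [|c s IH].
  have -> : seq_mset [seq emb c | c <- [::]] = mset0 :> monomial.
    by apply/msetP => i; rewrite mset_seqE mset0E.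
  by rewrite big_nil.
rewrite big_cons IH {1}/xvar malgUM map_cons mset_cons; reflexivity.
Qed.

Lemma qvarX k : qvar ^+ k = ('X^k)%:MP.
Proof. by rewrite /qvar -rmorphXn. Qed.

Definition agree (f : series) (p : polyring) : Prop :=
  forall m, bounded m -> f m = p@_m.

Lemma gen_series_fin (T : choiceType) (S : finType) (B : set T)
    (mon : T -> monomial) (w : T -> {poly int}) (h : S -> T) (Sp : pred S) m :
  injective h -> (forall s, Sp s -> B (h s)) ->
  (forall t, B t -> mon t = m -> exists2 s, Sp s & h s = t) ->
  gen_series B mon w m = \sum_(s | Sp s && (mon (h s) == m)) w (h s).
Proof.
move=> h_inj hB Bh; rewrite /gen_series.
rewrite (fsbig_fwiden [seq h s | s <- enum [pred s | Sp s && (mon (h s) == m)]]).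
- by rewrite big_map big_enum.
- move=> t [Bt mt] /=; have [s Ss sE] := Bh t Bt mt; subst t.
  by apply: map_f; rewrite mem_enum inE Ss; apply/eqP.
- by rewrite map_inj_uniq // enum_uniq.
move=> t [/mapP[s]]; rewrite mem_enum inE => /andP[Ss /eqP ms] -> [].
by split=> //; exact: hB.
Qed.

Lemma mcoeff_term (c : {poly int}) (m1 m : monomial) :
  (c%:MP * << m1 >> : polyring)@_m = if m1 == m then c else 0.
Proof. by rewrite mcoeffCM mcoeffU; case: eqP => _; rewrite ?mulr1 ?mulr0. Qed.

Lemma chromatic_agree (V : finType) (E : rel V) :
  agree (chromatic_qsym E) (colouring_sum qvar (@nat_of_ord _) xvar E).
Proof.
move=> m mB; pose h (F : {ffun V -> C}) : {ffun V -> posint} := [ffun v => emb (F v)].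
rewrite /chromatic_qsym (@gen_series_fin _ _ _ _ _ h (fun F => properb E F)).
- rewrite /colouring_sum raddf_sum big_mkcond /=; apply: eq_bigr => F _.
  rewrite edge_weightE; case: (properb E F); rewrite ?mulr0 ?mcoeff0 //=.
  rewrite mulrC qvarX -(big_enum _ _ xpredT (fun v => xvar (F v))) /=.
  rewrite -(big_map (fun v => F v) xpredT xvar) xvar_prod mcoeff_term -map_comp.
  rewrite (eq_map (g := h F)); last by move=> v; rewrite /= ffunE.
  case: ifP => // _; congr ('X^_); apply: eq_card => -[u v].
  by rewrite !inE /= !ffunE.
- move=> F G /ffunP FG; apply/ffunP => v; apply: emb_inj.
  by have := FG v; rewrite !ffunE.
- move=> F /forallP pF u v uv; rewrite !ffunE => /emb_inj Fuv.
  by have /forallP/(_ v) := pF u; rewrite uv Fuv eqxx.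
move=> F pF mE.
have /fin_all_exists[G GE] v : exists c, emb c = F v.
  apply: embP; apply: mB; rewrite -mE in_mset mset_seqE -has_count has_pred1.
  by apply: map_f; rewrite mem_enum.
exists [ffun v => G v]; last by apply/ffunP => v; rewrite !ffunE.
apply/forallP => u; apply/forallP => v; apply/implyP => /pF Fuv.
by rewrite !ffunE; apply/eqP => Guv; apply: Fuv; rewrite -!GE Guv.
Qed.

Lemma elem_agree k : agree (elem k) (elsym xvar k).
Proof.
move=> m mB; pose h (J : {set C}) : {fset posint} := [fset emb c | c in J]%fset.
have hJ J c : (emb c \in h J) = (c \in J).
  by rewrite mem_imfset //; exact: emb_inj.
have card_h J : #|` h J|%fset = #|J|.
  rewrite /h card_imfset /=; last exact: emb_inj.
  by rewrite cardE; apply: perm_size; apply: uniq_perm; rewrite ?enum_finpred_uniq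
     ?enum_uniq // => c; rewrite ?mem_enum.
rewrite /elem (@gen_series_fin _ _ _ _ _ h (fun J => #|J| == k)).
- rewrite /elsym raddf_sum big_mkcondr /=; apply: eq_bigr => J _.
  rewrite -(big_enum _ _ (mem J) xvar) xvar_prod mcoeffU.
  have -> : seq_mset (enum_fset (h J)) = seq_mset [seq emb c | c <- enum J].
    apply/eq_seq_msetP/uniq_perm; rewrite ?fset_uniq ?map_inj_uniq ?enum_uniq //.
      exact: emb_inj.
    move=> i; apply/imfsetP/mapP => /= -[c cJ ->]; exists c => //;
      by rewrite ?mem_enum // -mem_enum.
  by case: eqP.
- by move=> J K JK; apply/setP => c; rewrite -!hJ JK.
- by move=> J /eqP <- /=; rewrite card_h.
move=> I Ik mE; pose J := [set c | emb c \in I].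
have hI : h J = I.
  apply/fsetP => i; apply/imfsetP/idP => /= [[c + ->]|iI]; first by rewrite inE.
  have [c cE] : exists c, emb c = i.
    by apply: embP; apply: mB; rewrite -mE in_mset mset_seqE -has_count has_pred1.
  by exists c; rewrite // inE cE.
by exists J => //; apply/eqP; rewrite -card_h hI.
Qed.

Lemma smul_agree f g p p' : agree f p -> agree g p' -> agree (smul f g) (p * p').
Proof.
move=> fp gp m mB; rewrite /smul.
rewrite (eq_fsbigr (fun k : monomial * monomial => p@_k.1 * p'@_k.2)); last first.
  move=> k /set_mem /= km; congr (_ * _); [apply: fp|apply: gp] => i ik;
    by apply: mB; rewrite -km in_msetD ik ?orbT.
(* Outside the supports of [p] and [p'] the coefficient products vanish, so finitely many pairs
   suffice. *)
rewrite (fsbigE [seq k <- [seq (k1, k2) | k1 <- msupp p, k2 <- msupp p'] |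
                 msetD k.1 k.2 == m]).
- rewrite big_filter_cond big_mkcond big_allpairs_dep mcoeffMl.
  apply: eq_bigr => k1 _; apply: eq_bigr => k2 _ /=.
  have -> : (((k1, k2) : monomial * monomial) \in
      [set k | (k.1 `+` k.2)%mset = m]%classic) = ((k1 `+` k2)%mset == m).
    by apply/idP/eqP => [/set_mem|/mem_set].
  by rewrite andbb; case: eqP.
- by rewrite filter_uniq // allpairs_uniq // => -[? ?] [].
- by move=> k /=; rewrite mem_filter => /andP[/eqP].
move=> [k1 k2] /= km; rewrite mem_filter /= km eqxx /= => nk.
have [k1p|/mcoeff_outdom ->] := boolP (k1 \in msupp p); last by rewrite mul0r.
have [k2p|/mcoeff_outdom ->] := boolP (k2 \in msupp p'); last by rewrite mulr0.
by move/negP: nk; case; apply/allpairsP; exists (k1, k2).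
Qed.

Lemma elem_part_agree mu : agree (elem_part mu) (\prod_(k <- mu) elsym xvar k).
Proof.
elim: mu => [|k mu IH] /=.
  by rewrite big_nil => m _; rewrite mcoeff1.
rewrite big_cons; apply: smul_agree IH; exact: elem_agree.
Qed.

End Truncation.

Lemma sector_part_prod (A : comNzRingType) (r : nat) (n : 'I_r -> nat)
    (theta : {set union_vertex n * union_vertex n}) (e : nat -> A) :
  \prod_(k <- sector_part theta) e k = \prod_(s | sink theta s) e #|sector theta s|.
Proof.
rewrite /sector_part (perm_big _ (permEl (perm_sort _ _))) big_map /=.
by rewrite big_enum.
Qed.

Theorem mainTheorem13 (r : nat) (n : 'I_r -> nat)
    (a : forall i : 'I_r, {ffun 'I_(n i) -> nat})
    (ha : forall i : 'I_r, is_PCKB (a i)) :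
  chromatic_qsym (union_edge a) =
  \sum_(theta in AO (union_edge a))
     'X^(asc_orientation (union_edge a) theta) *: elem_part (sector_part theta).
Proof.
apply: funext => m; pose N := (\max_(i <- enum_mset m) val i)%N.
have mB : bounded N m.
  by move=> i im; apply: leqW; rewrite /N; apply: (leq_bigmax_seq (F := fun i : posint => val i)).
rewrite (chromatic_agree _ mB) colouring_sum_union.
have rho_inj : injective (@nat_of_ord N.+1) := @ord_inj _.
rewrite (eq_bigr _ (fun i _ => component_sum (qvar : polyring) rho_inj (@xvar N) ord0 (ha i))).
rewrite -orientation_sum_union raddf_sum /=.
transitivity (\sum_(theta in AO (union_edge a))
  'X^(asc_orientation (union_edge a) theta) * elem_part (sector_part theta) m).
  apply: eq_bigr => theta _.
  by rewrite qvarX mcoeffCM (elem_part_agree _ mB) sector_part_prod.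
by rewrite (big_morph (fun f : series => f m) (id1 := 0) (op1 := +%R)).
Qed.
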